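(* Let $K$ be an algebraically closed field of characteristic $2$, let $m\ge 1$, let $V$ be a $2m$-dimensional $K$-vector space with a non-degenerate alternating bilinear form $f$, and let $G=Sp(V)$. Let $DV$ be the divided power algebra of $V$, regarded as a complex with differential given by multiplication by $\omega=\sum_{i=1}^m x_iy_i\in D_2V$, with cohomology $H^j(DV)$. Then $H^m(DV)\simeq L(\omega_m)$ as $G$-modules, where $L(\omega_m)$ is the irreducible rational $G$-module of highest weight $\omega_m$.
   Context: Divided power algebra: $DV=\bigoplus_{k\ge 0}D_kV$ is the commutative graded $K$-algebra generated by divided powers $v^{(a)}\in D_aV$ ($v\in V$, $a\ge 0$), with $v^{(0)}=1$, $v^{(1)}=v$, $v^{(a)}v^{(b)}=\binom{a+b}{a}v^{(a+b)}$, $(tv)^{(a)}=t^av^{(a)}$ for $t\in K$, and $(u+v)^{(a)}=\sum_{i=0}^a u^{(i)}v^{(a-i)}$. If $v_1,\dots,v_n$ is a basis of $V$, then the monomials $v_1^{(a_1)}\cdots v_n^{(a_n)}$ with $a_1+\cdots+a_n=k$ form a basis of $D_kV$. Linear automorphisms $g$ of $V$ act on $DV$ by algebra automorphisms with $g(v^{(a)})=(gv)^{(a)}$. The complex $DV$: fix a basis $x_1,y_1,\dots,x_m,y_m$ of $V$ with $f(x_i,y_j)=\delta_{ij}$ and $f(x_i,x_j)=f(y_i,y_j)=0$. Let $\omega=x_1y_1+\cdots+x_my_m\in D_2V$ and let $\partial_k:D_kV\to D_{k+2}V$ be multiplication by $\omega$. In characteristic $2$ one has $\partial_{k+2}\partial_k=0$,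 and $\partial$ is equivariant for $G=Sp(V)$. Put $H^k(DV)=\ker\partial_k/\mathrm{Im}\,\partial_{k-2}$ (with $D_jV=0$ for $j<0$); this is a $G$-module. Weights: with respect to the ordered basis $x_1,\dots,x_m,y_m,\dots,y_1$ identify $G$ with $Sp(2m,K)=\{A\in GL(2m,K): A^tJA=J\}$, $J$ being the matrix of $f$. Let $T=\{\mathrm{diag}(t_1,\dots,t_m,t_m^{-1},\dots,t_1^{-1})\}$ be the maximal torus, and $\varepsilon_i:T\to K^{\times}$ the $i$-th diagonal entry. The simple roots are $\varepsilon_i-\varepsilon_{i+1}$ ($1\le i<m$) and $2\varepsilon_m$; the positive roots are $\varepsilon_i\pm\varepsilon_j$ ($i<j\le m$) and $2\varepsilon_k$; the fundamental dominant weights are $\omega_i=\varepsilon_1+\cdots+\varepsilon_i$, $1\le i\le m$. For a dominant weight $\lambda$, $L(\lambda)$ is the (unique up to isomorphism) irreducible rational $G$-module of highest weight $\lambda$. *)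

(* Defs.v *)
From HB Require Import structures.
From mathcomp Require Import all_boot all_order all_algebra.
From mathcomp Require Import sesquilinear ring_quotient.
From mathcomp Require Import boolp.
From mathcomp Require Import finmap monalg.

Set Implicit Arguments.
Unset Strict Implicit.
Unset Printing Implicit Defensive.

Import GRing.Theory.
Import Quotient.
Local Open Scope ring_scope.
Local Open Scope quotient_scope.

(* Locked: unification would otherwise unfold finitely supported maps. *)
HB.lock Definition sym_var (K : fieldType) (I : choiceType) (i : I) :
  {malg K[{cmonom I}]} := << ucm i >>.

Lemma sym_varE (K : fieldType) (I : choiceType) (i : I) :
  sym_var K i = << ucm i >>.
Proof. by rewrite unlock. Qed.

Section FreeCommutativeAlgebra.
Variables (K : fieldType) (I : choiceType).

Local Notation sym_var := (@sym_var K I).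

Variables (A : comAlgType K) (c : I -> A).

Definition monom_eval (mu : {cmonom I}) : A :=
  \prod_(i <- finsupp mu) c i ^+ mu i.

Lemma monom_evalw (d : {fset I}) (mu : {cmonom I}) :
  (finsupp mu `<=` d)%fset -> monom_eval mu = \prod_(i <- d) c i ^+ mu i.
Proof.
move=> le; rewrite [LHS](big_fset_incl _ le) //= => i _.
by rewrite -cmE_eq0 => /eqP ->; rewrite expr0.
Qed.

Lemma monom_eval_mmorphism : mmorphism monom_eval.
Proof.
split=> [m1 m2|]; last by rewrite /monom_eval mdom1 big_seq_fset0.
rewrite (@monom_evalw (finsupp m1 `|` finsupp m2)%fset) ?mdomD //.
rewrite (monom_evalw (fsubsetUl _ (finsupp m2))).
rewrite (monom_evalw (fsubsetUr (finsupp m1) _)) -big_split /=.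
by apply: eq_bigr => i _; rewrite cmM exprD.
Qed.

HB.instance Definition _ :=
  monalg.isMultiplicative.Build _ A monom_eval monom_eval_mmorphism.

Definition sym_eval : {malg K[{cmonom I}]} -> A :=
  mmap (in_alg A) monom_eval.

HB.instance Definition _ := GRing.RMorphism.on sym_eval.

Lemma sym_evalZ a p : sym_eval (a *: p) = a *: sym_eval p.
Proof. by rewrite /sym_eval mmapZ /= mulr_algl. Qed.

HB.instance Definition _ :=
  GRing.isScalable.Build K {malg K[{cmonom I}]} A *:%R sym_eval sym_evalZ.

Lemma sym_evalM p q : sym_eval (p * q) = sym_eval p * sym_eval q.
Proof. exact: rmorphM. Qed.

Lemma sym_eval_var i : sym_eval (sym_var i) = c i.
Proof.
rewrite sym_varE /sym_eval mmapU /= scale1r mul1r /monom_eval mdomU big_seq_fset1.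
by rewrite cmUU expr1.
Qed.

Lemma sym_var_ext (B : comPzRingType)
    (phi psi : {rmorphism {malg K[{cmonom I}]} -> B}) :
  (forall a, phi (a *: 1) = psi (a *: 1)) ->
  (forall i, phi (sym_var i) = psi (sym_var i)) -> phi =1 psi.
Proof.
move=> eqC eqV p; rewrite (monalgE p) !rmorph_sum; apply: eq_bigr => mu _ /=.
have -> : << p@_mu *g mu >> = (p@_mu *: 1) * << mu >>
    :> {malg K[{cmonom I}]}.
  have -> : p@_mu *: 1 = (p@_mu)%:MP :> {malg K[{cmonom I}]}.
    by rewrite -mul_malgC mulr1.
  by rewrite malgM_def fgmulUU mulr1 monalg.mul1m.
rewrite (rmorphM phi) (rmorphM psi) eqC; congr (_ * _).
have [n le_n] := ubnP (mdeg mu); elim: n => // n IH in mu le_n *.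
have [mu1|] := eqVneq (finsupp mu) fset0.
  have -> : << mu >> = 1 :> {malg K[{cmonom I}]}.
    by congr (<< _ >>); apply/eqP/cmP => i; rewrite cm1; apply/eqP;
      rewrite cmE_eq0 mu1 inE.
  by rewrite !rmorph1.
case/fset0Pn => i; rewrite -cmE_neq0 => mui.
have Dmu : mu = mulcm (ucm i) (divcm mu (ucm i)).
  apply/eqP/cmP => j; rewrite mulcmE divcmE ucmE.
  by case: eqVneq => [<-|_] /=; rewrite ?subn0 // subnKC ?lt0n.
have -> : << mu >> = sym_var i * << divcm mu (ucm i) >> :> {malg K[{cmonom I}]}.
  by rewrite {1}Dmu sym_varE malgM_def fgmulUU mulr1.
have eqI : phi << divcm mu (ucm i) >> = psi << divcm mu (ucm i) >>.
  apply: IH.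
  have Ddeg : mdeg mu = (1 + mdeg (divcm mu (ucm i)))%N.
    by rewrite {1}Dmu (mdegM (ucm i)) mdegU.
  by rewrite Ddeg in le_n.
move: (sym_var i) (<< _ >>) (eqV i) eqI => s t eq_s eq_t.
by rewrite !rmorphM /= eq_s eq_t.
Qed.

End FreeCommutativeAlgebra.

Section IdealGenerated.
Variables (R : comNzRingType) (rel : R -> Prop).

Definition ideal_gen : {pred R} := fun p =>
  `[< exists s : seq (R * R),
        (forall q, q \in s -> rel q.2) /\ p = \sum_(q <- s) q.1 * q.2 >].

Lemma ideal_gen0 : 0 \in ideal_gen.
Proof. by apply/asboolP; exists [::]; rewrite big_nil. Qed.

Lemma ideal_genR p : rel p -> p \in ideal_gen.
Proof.
move=> Rp; apply/asboolP; exists [:: (1, p)].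
by split=> [q|]; rewrite ?inE ?big_seq1 ?mul1r // => /eqP ->.
Qed.

Lemma ideal_genP r : {in ideal_gen &, forall p q, r * p + q \in ideal_gen}.
Proof.
move=> p q /asboolP [s [sR ->]] /asboolP [s' [sR' ->]]; apply/asboolP.
exists ([seq (r * t.1, t.2) | t <- s] ++ s'); split.
  move=> t; rewrite mem_cat => /orP [/mapP [t' /sR Rt' ->] //|/sR' //].
rewrite big_cat big_map mulr_sumr /=; congr (_ + _).
by apply: eq_bigr => t _; rewrite mulrA.
Qed.

Lemma ideal_gen_ker (S : comNzRingType) (phi : {rmorphism R -> S}) :
  (forall p, rel p -> phi p = 0) -> {in ideal_gen, forall p, phi p = 0}.
Proof.
move=> phi0 p /asboolP [s [sR ->]].
rewrite rmorph_sum big_seq big1 //= => q /sR /phi0 phiq.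
by rewrite rmorphM phiq mulr0.
Qed.

End IdealGenerated.

Section QuotientAlgebra.
Variables (K : fieldType) (A : comAlgType K) (I : idealr A).

Definition quot_alg : Type := {quot I}.

HB.instance Definition _ := GRing.ComNzRing.on quot_alg.

Definition quot_pi : A -> quot_alg := \pi_{quot I}.

HB.instance Definition _ := GRing.RMorphism.on quot_pi.

Lemma quot_piP x : exists p, x = quot_pi p.
Proof. by exists (repr x); rewrite /quot_pi reprK. Qed.

Lemma quot_pi_eq p q : (quot_pi p = quot_pi q) <-> (p - q \in I).
Proof. by rewrite idealrBE; split=> [/eqP|/eqP]. Qed.

Definition quot_scale (t : K) (x : quot_alg) : quot_alg := quot_pi t%:A * x.

Fact quot_scaleA a b x : quot_scale a (quot_scale b x) = quot_scale (a * b) x.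
Proof. by rewrite /quot_scale mulrA -rmorphM mulr_algl scalerA. Qed.
Fact quot_scale1 : left_id 1 quot_scale.
Proof. by move=> x; rewrite /quot_scale scale1r rmorph1 mul1r. Qed.
Fact quot_scaleDr : right_distributive quot_scale +%R.
Proof. by move=> a x y; rewrite /quot_scale mulrDr. Qed.
Fact quot_scaleDl x : {morph quot_scale^~ x : a b / a + b}.
Proof. by move=> a b; rewrite /quot_scale scalerDl rmorphD mulrDl. Qed.

HB.instance Definition _ := GRing.Zmodule_isLmodule.Build K quot_alg
  quot_scaleA quot_scale1 quot_scaleDr quot_scaleDl.

Fact quot_scaleAl (a : K) (x y : quot_alg) : a *: (x * y) = (a *: x) * y.
Proof. exact: mulrA. Qed.

HB.instance Definition _ := GRing.Lmodule_isLalgebra.Build K quot_alg quot_scaleAl.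
HB.instance Definition _ := GRing.Lalgebra_isComAlgebra.Build K quot_alg.

Fact quot_pi_scalable : scalable quot_pi.
Proof. by move=> a p; rewrite -mulr_algl rmorphM. Qed.
HB.instance Definition _ :=
  GRing.isScalable.Build K A quot_alg *:%R quot_pi quot_pi_scalable.

Lemma quot_rel1 p : p - 1 \in I -> quot_pi p = 1.
Proof. by rewrite -(rmorph1 quot_pi) => /quot_pi_eq. Qed.

Lemma quot_relM p q a r :
  p * q - a *: r \in I -> quot_pi p * quot_pi q = a *: quot_pi r.
Proof. by rewrite -rmorphM -linearZ => /quot_pi_eq. Qed.

Lemma quot_relZ p a r : p - a *: r \in I -> quot_pi p = a *: quot_pi r.
Proof. by rewrite -linearZ => /quot_pi_eq. Qed.

Lemma quot_relD p n (u v : 'I_n -> A) :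
  p - \sum_i u i * v i \in I -> quot_pi p = \sum_i quot_pi (u i) * quot_pi (v i).
Proof.
move=> /quot_pi_eq ->; rewrite rmorph_sum.
by apply: eq_bigr => i _; rewrite rmorphM.
Qed.

Section Lift.
Variables (B : comAlgType K) (phi : {lrmorphism A -> B}).
Hypothesis phi0 : {in I, forall p, phi p = 0}.

Definition quot_lift of {in I, forall p, phi p = 0} :=
  fun x : quot_alg => phi (repr x).

Lemma quot_lift_pi p : quot_lift phi0 (quot_pi p) = phi p.
Proof.
apply/eqP; rewrite /quot_lift -subr_eq0 -rmorphB; apply/eqP/phi0.
by apply/quot_pi_eq; rewrite /quot_pi reprK.
Qed.

Fact quot_lift_zmod : zmod_morphism (quot_lift phi0).
Proof.
move=> x y; have [[p ->] [q ->]] := (quot_piP x, quot_piP y).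
by rewrite -rmorphB !quot_lift_pi rmorphB.
Qed.
HB.instance Definition _ :=
  GRing.isZmodMorphism.Build quot_alg B (quot_lift phi0) quot_lift_zmod.

Fact quot_lift_monoid : monoid_morphism (quot_lift phi0).
Proof.
split=> [|x y]; first by rewrite -(rmorph1 quot_pi) quot_lift_pi rmorph1.
have [[p ->] [q ->]] := (quot_piP x, quot_piP y).
by rewrite -rmorphM !quot_lift_pi rmorphM.
Qed.
HB.instance Definition _ :=
  GRing.isMonoidMorphism.Build quot_alg B (quot_lift phi0) quot_lift_monoid.

Fact quot_lift_scalable : scalable (quot_lift phi0).
Proof.
move=> a x; have [p ->] := quot_piP x.
by rewrite -linearZ !quot_lift_pi linearZ.
Qed.
HB.instance Definition _ :=
  GRing.isScalable.Build K quot_alg B *:%R (quot_lift phi0) quot_lift_scalable.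

End Lift.

End QuotientAlgebra.

Section DividedPowers.
Variables (K : fieldType) (V : vectType K).

Notation P := {malg K[{cmonom (V * nat)%type}]}.

Definition dsym (v : V) (a : nat) : P := sym_var K (v, a).

Lemma sym_eval_dsym (A : comAlgType K) (c : V * nat -> A) v a :
  sym_eval c (dsym v a) = c (v, a).
Proof. exact: sym_eval_var. Qed.

(* No relator for v^(1) = v: the vector v is identified with the symbol v^(1). *)
Inductive dp_relator : P -> Prop :=
| DpOne v : dp_relator (dsym v 0 - 1)
| DpMul v a b :
    dp_relator (dsym v a * dsym v b - 'C(a + b, a)%:R *: dsym v (a + b))
| DpScale t v a : dp_relator (dsym (t *: v) a - t ^+ a *: dsym v a)
| DpAdd u v a :
    dp_relator (dsym (u + v) a - \sum_(i < a.+1) dsym u i * dsym v (a - i)).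

Definition dp_ideal : {pred P} := ideal_gen dp_relator.

(* The relations as equations: a family c (v, a) in A satisfying them. *)
Definition dp_compatible (A : comAlgType K) (c : V * nat -> A) :=
  [/\ forall v, c (v, 0%N) = 1,
      forall v a b, c (v, a) * c (v, b) = 'C(a + b, a)%:R *: c (v, (a + b)%N),
      forall t v a, c (t *: v, a) = t ^+ a *: c (v, a)
    & forall u v a,
        c (u + v, a) = \sum_(i < a.+1) c (u, val i) * c (v, (a - i)%N)].

Lemma sym_eval_ideal (A : comAlgType K) (c : V * nat -> A) :
  dp_compatible c -> {in dp_ideal, forall p, sym_eval c p = 0}.
Proof.
move=> [c1 cM cZ cD] p; apply: (ideal_gen_ker (phi := sym_eval c)) => {}p.
case=> [v|v a b|t v a|u v a]; rewrite (rmorphB (sym_eval c)) /=.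
- by rewrite sym_eval_dsym rmorph1 c1 subrr.
- by rewrite sym_evalM sym_evalZ !sym_eval_dsym cM subrr.
- by rewrite sym_evalZ !sym_eval_dsym cZ subrr.
- rewrite (rmorph_sum (sym_eval c)) sym_eval_dsym cD /=.
  under [X in _ - X]eq_bigr => i _ do rewrite sym_evalM !sym_eval_dsym.
  exact: subrr.
Qed.

Lemma augmentation_compatible :
  dp_compatible (fun p : V * nat => (p.2 == 0%N)%:R : K^o).
Proof.
split=> [v|v a b|t v a|u v a] //=.
- by rewrite addn_eq0; case: a b => [|a] [|b] /=;
    rewrite ?(mulr0, mul0r, scaler0, mulr1) // bin0 scale1r.
- by case: a => [|a] /=; rewrite ?expr0 ?scale1r ?scaler0.
- rewrite big_ord_recl /= mul1r subn0 big1 ?addr0 // => i _.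
  by rewrite /= mul0r.
Qed.

Lemma dp_ideal_closed : idealr_closed dp_ideal.
Proof.
split; [exact: ideal_gen0 | | exact: ideal_genP].
apply/negP => /(sym_eval_ideal augmentation_compatible).
by rewrite rmorph1 => /eqP; rewrite oner_eq0.
Qed.

HB.instance Definition _ := isIdealr.Build P dp_ideal dp_ideal_closed.

End DividedPowers.

(* The algebra with its family v^(a).  Locked: the canonical structures of the
   quotient are expensive to unfold, and DV_lift and DV_ext below determine it. *)
HB.lock Definition DV_with_powers (K : fieldType) (V : vectType K) :
    {A : comAlgType K & V -> nat -> A} :=
  existT (fun A : comAlgType K => V -> nat -> A) (quot_alg (@dp_ideal K V))
    (fun v a => quot_pi (@dp_ideal K V) (dsym v a)).

Definition DV (K : fieldType) (V : vectType K) : comAlgType K :=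
  projT1 (DV_with_powers V).

(* dpow v a is the divided power v^(a). *)
Definition dpow (K : fieldType) (V : vectType K) : V -> nat -> DV V :=
  projT2 (DV_with_powers V).

Section DividedPowerAlgebra.
Variables (K : fieldType) (V : vectType K).

Lemma dpow_compatible : dp_compatible (fun p : V * nat => dpow p.1 p.2).
Proof.
rewrite /dpow /DV unlock /=.
have R p : dp_relator p -> p \in @dp_ideal K V by exact: ideal_genR.
split=> [v|v a b|t v a|u v a].
- exact: (quot_rel1 (R _ (DpOne v))).
- exact: (quot_relM (R _ (DpMul v a b))).
- exact: (quot_relZ (R _ (DpScale t v a))).
- exact: (quot_relD (R _ (DpAdd u v a))).
Qed.

Section Lift.
Variables (A : comAlgType K) (c : V * nat -> A) (hc : dp_compatible c).

Fact DV_lift_subproof :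
  {phi : {lrmorphism DV V -> A} | forall v a, phi (dpow v a) = c (v, a)}.
Proof.
rewrite /dpow /DV unlock /=.
exists (quot_lift (phi := sym_eval c) (sym_eval_ideal hc)) => v a.
apply: etrans (sym_eval_dsym c v a).
exact: (quot_lift_pi (phi := sym_eval c) (sym_eval_ideal hc) (dsym v a)).
Qed.

Definition DV_lift : {lrmorphism DV V -> A} := sval DV_lift_subproof.

Lemma DV_lift_dpow v a : DV_lift (dpow v a) = c (v, a).
Proof. exact: (svalP DV_lift_subproof). Qed.

End Lift.

Lemma DV_ext (A : comAlgType K) (phi psi : {lrmorphism DV V -> A}) :
  (forall v a, phi (dpow v a) = psi (dpow v a)) -> phi =1 psi.
Proof.
move: phi psi; rewrite /dpow /DV unlock /= => phi psi eqg x.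
have [p ->] := quot_piP x.
pose pi := quot_pi (@dp_ideal K V).
apply: (@sym_var_ext _ _ _ (phi \o pi) (psi \o pi)) => [a|[v a]] /=.
  by rewrite linearZZ !linearZ !rmorph1.
exact: eqg.
Qed.

Definition dp_monomial (s : seq (V * nat)) : DV V := \prod_(p <- s) dpow p.1 p.2.

(* The component D_k V. *)
Definition homog (k : nat) : {pred DV V} := fun z =>
  `[< exists s : seq (K * seq (V * nat)),
        (forall t, t \in s -> sumn (unzip2 t.2) = k) /\
        z = \sum_(t <- s) t.1 *: dp_monomial t.2 >].

Lemma homog_submod k : submod_closed (homog k).
Proof.
split=> [|a x y]; first by apply/asboolP; exists [::]; rewrite big_nil.
move=> /asboolP [s [ds ->]] /asboolP [s' [ds' ->]]; apply/asboolP.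
exists ([seq (a * t.1, t.2) | t <- s] ++ s'); split.
  by move=> t; rewrite mem_cat => /orP [/mapP [t' /ds <- ->] //|/ds'].
rewrite big_cat big_map scaler_sumr /=; congr (_ + _).
by apply: eq_bigr => t _; rewrite scalerA.
Qed.

HB.instance Definition _ k :=
  GRing.isSubmodClosed.Build K (DV V) (homog k) (homog_submod k).

End DividedPowerAlgebra.

Record symplectic_form (K : fieldType) (V : vectType K) := SymplecticForm {
  sform :> {bilinear V -> V -> K | *%R & *%R};
  sform_alternating : forall v, sform v v = 0;
  sform_nondegenerate : forall u, (forall v, sform u v = 0) -> u = 0
}.

Section SymplecticGroup.
Variables (K : fieldType) (V : vectType K) (f : symplectic_form V).

Definition is_symplectic_aut (g : 'End(V)) : bool :=
  (lker g == 0%VS) && `[< forall u v, f (g u) (g v) = f u v >].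

Record Sp := MkSp { Sp_fun :> 'End(V); SpP : is_symplectic_aut Sp_fun }.

HB.instance Definition _ := [isSub for Sp_fun].
HB.instance Definition _ := [Choice of Sp by <:].

Lemma Sp_form (g : Sp) u v : f (g u) (g v) = f u v.
Proof. by case/andP: (SpP g) => _ /asboolP ->. Qed.

Lemma Sp_lker (g : Sp) : lker g == 0%VS.
Proof. by case/andP: (SpP g). Qed.

Fact Sp_one_proof : is_symplectic_aut \1%VF.
Proof.
apply/andP; split; first by apply/lker0P => u v; rewrite !id_lfunE.
by apply/asboolP => u v; rewrite !id_lfunE.
Qed.
Fact Sp_mul_proof (g h : Sp) : is_symplectic_aut (g \o h)%VF.
Proof.
apply/andP; split; last by apply/asboolP => u v; rewrite !comp_lfunE !Sp_form.
apply/lker0P => u v; rewrite !comp_lfunE.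
by move/(lker0P (Sp_lker g))/(lker0P (Sp_lker h)).
Qed.
Fact Sp_inv_proof (g : Sp) : is_symplectic_aut (g^-1)%VF.
Proof.
apply/andP; split; last first.
  by apply/asboolP => u v; rewrite -[LHS](Sp_form g) !lker0_lfunVK ?Sp_lker.
apply/lker0P => u v /(congr1 g); by rewrite !lker0_lfunVK ?Sp_lker.
Qed.

Definition Sp_one := MkSp Sp_one_proof.
Definition Sp_mul g h := MkSp (Sp_mul_proof g h).
Definition Sp_inv g := MkSp (Sp_inv_proof g).

Fact Sp_mulA : associative Sp_mul.
Proof. by move=> g h k; apply/val_inj; rewrite /= comp_lfunA. Qed.
Fact Sp_mul1 : left_id Sp_one Sp_mul.
Proof. by move=> g; apply/val_inj; rewrite /= comp_lfun1l. Qed.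
Fact Sp_mulV : left_inverse Sp_one Sp_inv Sp_mul.
Proof. by move=> g; apply/val_inj; rewrite /= lker0_compVf ?Sp_lker. Qed.
Fact Sp_1mul : right_id Sp_one Sp_mul.
Proof. by move=> g; apply/val_inj; rewrite /= comp_lfun1r. Qed.
Fact Sp_Vmul : right_inverse Sp_one Sp_inv Sp_mul.
Proof. by move=> g; apply/val_inj; rewrite /= lker0_compfV ?Sp_lker. Qed.

HB.instance Definition _ :=
  isGroup.Build Sp Sp_mulA Sp_mul1 Sp_1mul Sp_mulV Sp_Vmul.

End SymplecticGroup.

Record gmodule (K : fieldType) (G : groupType) := Gmodule {
  gmod_car :> lmodType K;
  gact : G -> {linear gmod_car -> gmod_car};
  gact1 : forall v, gact 1%g v = v;
  gactM : forall g h v, gact (g * h)%g v = gact g (gact h v)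
}.

Arguments gact {K G M} _ : rename.
Arguments gact1 {K G M} v : rename.
Arguments gactM {K G M} g h v : rename.

Section GmoduleTheory.
Variables (K : fieldType) (G : groupType).
Implicit Types M N : gmodule K G.

Definition gstable M (S : {pred M}) := forall g v, v \in S -> gact g v \in S.

Definition gmod_irreducible M : Prop :=
  (exists v : M, v != 0) /\
  (forall S : {pred M}, submod_closed S -> gstable S ->
     (forall v, v \in S -> v = 0) \/ (forall v, v \in S)).

Definition gmod_isomorphic M N : Prop :=
  exists phi : {linear M -> N},
    bijective phi /\ forall g v, phi (gact g v) = gact g (phi v).

End GmoduleTheory.

Section Subquotient.
Variables (K : fieldType) (M : lmodType K).

Definition submod_of (Z : submodClosed M) : Type := {x : M | x \in Z}.

Section Sub.
Variable Z : submodClosed M.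
HB.instance Definition _ := SubType.on (submod_of Z).
HB.instance Definition _ := [Choice of submod_of Z by <:].
HB.instance Definition _ := [SubChoice_isSubLmodule of submod_of Z by <:].
End Sub.

Variables Z B : submodClosed M.

Definition sub_pred : {pred submod_of Z} := fun z => val z \in B.

Fact sub_pred_closed : submod_closed sub_pred.
Proof.
have predE z : (z \in sub_pred) = (val z \in B) by [].
split=> [|a x y]; rewrite !predE ?rpred0 // => Bx By.
by rewrite linearP rpredD ?rpredZ.
Qed.

HB.instance Definition _ :=
  GRing.isSubmodClosed.Build K (submod_of Z) sub_pred sub_pred_closed.

Definition subquotient : Type := {quot sub_pred}.

HB.instance Definition _ := GRing.Zmodule.on subquotient.

Definition subq_pi : submod_of Z -> subquotient := \pi_{quot sub_pred}.

HB.instance Definition _ := GRing.isZmodMorphism.Build (submod_of Z) subquotient subq_pi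
  (raddfB (\pi_{quot sub_pred})).

Lemma subq_piP x : exists z, x = subq_pi z.
Proof. by exists (repr x); rewrite /subq_pi reprK. Qed.

Lemma subq_pi_eq z w : (subq_pi z = subq_pi w) <-> (val z - val w \in B).
Proof.
rewrite -[_ - _](raddfB (val : submod_of Z -> M)) -[_ \in B]/(z - w \in sub_pred).
by rewrite idealrBE; split=> [/eqP|/eqP].
Qed.

Definition subq_scale (a : K) (x : subquotient) : subquotient :=
  subq_pi (a *: repr x).

Lemma subq_scale_pi a z : subq_scale a (subq_pi z) = subq_pi (a *: z).
Proof.
have valZ (w : submod_of Z) : val (a *: w) = a *: val w by rewrite linearZ.
apply/subq_pi_eq; rewrite !valZ -scalerBr rpredZ //.
by apply/subq_pi_eq; rewrite /subq_pi reprK.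
Qed.

Fact subq_scaleA a b x : subq_scale a (subq_scale b x) = subq_scale (a * b) x.
Proof. by have [z ->] := subq_piP x; rewrite !subq_scale_pi scalerA. Qed.
Fact subq_scale1 : left_id 1 subq_scale.
Proof. by move=> x; have [z ->] := subq_piP x; rewrite subq_scale_pi scale1r. Qed.
Fact subq_scaleDr : right_distributive subq_scale +%R.
Proof.
move=> a x y; have [[z ->] [w ->]] := (subq_piP x, subq_piP y).
by rewrite -raddfD !subq_scale_pi scalerDr raddfD.
Qed.
Fact subq_scaleDl x : {morph subq_scale^~ x : a b / a + b}.
Proof.
by move=> a b; have [z ->] := subq_piP x; rewrite !subq_scale_pi scalerDl raddfD.
Qed.

HB.instance Definition _ := GRing.Zmodule_isLmodule.Build K subquotient
  subq_scaleA subq_scale1 subq_scaleDr subq_scaleDl.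

Fact subq_pi_scalable : scalable subq_pi.
Proof. by move=> a z; rewrite -subq_scale_pi. Qed.
HB.instance Definition _ :=
  GRing.isScalable.Build K (submod_of Z) subquotient *:%R subq_pi subq_pi_scalable.

End Subquotient.

Section SubquotientAction.
Variables (K : fieldType) (G : groupType) (M : gmodule K G).
Variables (Z B : submodClosed M) (sZ : gstable Z) (sB : gstable B).

Definition sub_act (g : G) (z : submod_of Z) : submod_of Z :=
  exist _ (gact g (val z)) (sZ g (valP z)).

Definition subq_act of gstable B := fun (g : G) (x : subquotient Z B) =>
  subq_pi B (sub_act g (repr x)).

Lemma subq_act_pi g z : subq_act sB g (subq_pi B z) = subq_pi B (sub_act g z).
Proof.
apply/subq_pi_eq => /=; rewrite -raddfB; apply: sB.
by apply/subq_pi_eq; rewrite /subq_pi reprK.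
Qed.

Fact subq_act_linear g : linear (subq_act sB g).
Proof.
move=> a x y; have [[z ->] [w ->]] := (subq_piP x, subq_piP y).
rewrite -linearP !subq_act_pi -linearP; congr subq_pi.
by apply: val_inj; rewrite /= linearP.
Qed.
HB.instance Definition _ g :=
  GRing.isLinear.Build K (subquotient Z B) (subquotient Z B) *:%R
    (subq_act sB g) (subq_act_linear g).

Fact subq_act1 x : subq_act sB 1%g x = x.
Proof.
have [z ->] := subq_piP x; rewrite subq_act_pi; congr subq_pi.
by apply: val_inj; rewrite /= gact1.
Qed.
Fact subq_actM g h x :
  subq_act sB (g * h)%g x = subq_act sB g (subq_act sB h x).
Proof.
have [z ->] := subq_piP x; rewrite !subq_act_pi; congr subq_pi.
by apply: val_inj; rewrite /= gactM.
Qed.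

(* The G-module Z / (Z :&: B); it is only used when B is contained in Z. *)
Definition subq_gmodule : gmodule K G :=
  @Gmodule K G (subquotient Z B : lmodType K) (fun g => subq_act sB g)
    subq_act1 subq_actM.

End SubquotientAction.

Record symplectic_basis (K : fieldType) (V : vectType K)
    (f : symplectic_form V) (m : nat) := SymplecticBasis {
  sb_x : 'I_m -> V;
  sb_y : 'I_m -> V;
  sb_basis : basis_of fullv ([seq sb_x i | i : 'I_m] ++ [seq sb_y i | i : 'I_m]);
  sb_xy : forall i j, f (sb_x i) (sb_y j) = (i == j)%:R;
  sb_xx : forall i j, f (sb_x i) (sb_x j) = 0;
  sb_yy : forall i j, f (sb_y i) (sb_y j) = 0
}.

Section Action.
Variables (K : fieldType) (V : vectType K) (f : symplectic_form V).

Fact dp_act_compatible (g : Sp f) :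
  dp_compatible (fun p : V * nat => dpow (g p.1) p.2).
Proof.
have [c1 cM cZ cD] := dpow_compatible V.
by split=> [v|v a b|t v a|u v a] /=;
  [exact: c1 | exact: cM | rewrite linearZ; exact: cZ
  | rewrite linearD; exact: cD].
Qed.

Definition dp_act (g : Sp f) : {lrmorphism DV V -> DV V} :=
  DV_lift (dp_act_compatible g).

Lemma dp_act_dpow g v a : dp_act g (dpow v a) = dpow (g v) a.
Proof. exact: DV_lift_dpow. Qed.

Fact dp_act1 x : dp_act 1%g x = x.
Proof.
apply: (@DV_ext _ _ _ (dp_act 1%g) idfun) => v a /=.
by rewrite dp_act_dpow id_lfunE.
Qed.

Fact dp_actM g h x : dp_act (g * h)%g x = dp_act g (dp_act h x).
Proof.
apply: (@DV_ext _ _ _ (dp_act (g * h)%g) (dp_act g \o dp_act h)) => v a /=.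
by rewrite !dp_act_dpow comp_lfunE.
Qed.

Definition DV_gmodule : gmodule K (Sp f) :=
  @Gmodule K (Sp f) (DV V) (fun g => dp_act g) dp_act1 dp_actM.

Lemma homog_stable k : gstable (M := DV_gmodule) (homog k).
Proof.
move=> g z /asboolP [s [ds ->]]; apply/asboolP.
exists [seq (t.1, [seq (g p.1, p.2) | p <- t.2]) | t <- s]; split.
  move=> t /mapP [t' /ds <- ->] /=.
  by rewrite /unzip2 -map_comp.
rewrite linear_sum big_map; apply: eq_bigr => t _ /=.
rewrite linearZ /= /dp_monomial big_map rmorph_prod; congr (_ *: _).
by apply: eq_bigr => p _; exact: dp_act_dpow.
Qed.

End Action.

Section Cohomology.
Variables (K : fieldType) (V : vectType K) (f : symplectic_form V) (m : nat).
Variables (B : symplectic_basis f m).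

Notation x := (sb_x B).
Notation y := (sb_y B).

Definition omega : DV V := \sum_(i < m) dpow (x i) 1 * dpow (y i) 1.

Definition cocycles (k : nat) : {pred DV V} :=
  fun z => (z \in homog k) && (omega * z == 0).

(* Im (D_(k-2) -> D_k), with D_j = 0 for j < 0. *)
Definition coboundaries (k : nat) : {pred DV V} := fun z =>
  if k is k'.+2 then `[< exists2 w, w \in homog k' & z = omega * w >]
  else z == 0.

Lemma cocyclesE k z : (z \in cocycles k) = (z \in homog k) && (omega * z == 0).
Proof. by []. Qed.

Lemma coboundariesP k z : z \in coboundaries k ->
  (k < 2)%N /\ z = 0 \/
  exists k', k = k'.+2 /\ exists2 w, w \in homog k' & z = omega * w.
Proof.
case: k => [|[|k]]; rewrite unfold_in /=.
- by move=> /eqP ->; left.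
- by move=> /eqP ->; left.
- by move=> /asboolP dz; right; exists k.
Qed.

Lemma mem_coboundaries k w :
  w \in homog k -> omega * w \in coboundaries k.+2.
Proof. by move=> dw; apply/asboolP; exists w. Qed.

Lemma coboundaries0 k : 0 \in coboundaries k.
Proof.
case: k => [|[|k]]; try exact: eqxx.
have : omega * 0 \in coboundaries k.+2 by apply: mem_coboundaries; exact: rpred0.
by rewrite mulr0.
Qed.

Fact cocycles_submod k : submod_closed (cocycles k).
Proof.
split=> [|a z w]; rewrite !cocyclesE; first by rewrite rpred0 mulr0 eqxx.
move=> /andP [dz /eqP oz] /andP [dw /eqP ow].
by rewrite rpredD ?rpredZ // mulrDr -scalerAr oz ow scaler0 addr0 eqxx.
Qed.

Fact coboundaries_submod k : submod_closed (coboundaries k).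
Proof.
split=> [|a z w]; first exact: coboundaries0.
case/coboundariesP => [[k2 ->]|[k' [Dk [z' dz ->]]]].
  by rewrite scaler0 add0r.
rewrite Dk => /coboundariesP [[//]|[k'' [[<-] [w' dw ->]]]].
rewrite scalerAr -mulrDr; apply: mem_coboundaries.
by rewrite rpredD ?rpredZ.
Qed.

HB.instance Definition _ k :=
  GRing.isSubmodClosed.Build K (DV V) (cocycles k) (cocycles_submod k).
HB.instance Definition _ k :=
  GRing.isSubmodClosed.Build K (DV V) (coboundaries k) (coboundaries_submod k).

Hypothesis char2 : 2%N \in [pchar K].

Let addKK (M : lmodType K) (v : M) : v + v = 0.
Proof. by rewrite -mulr2n -scaler_nat (pcharf0 char2) scale0r. Qed.

Let oppE (M : lmodType K) (v : M) : - v = v.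
Proof. by apply/eqP; rewrite eq_sym -addr_eq0 addKK. Qed.

Lemma sform_sym u v : f u v = f v u.
Proof.
have := sform_alternating f (u + v).
rewrite linearDl linearDr linearDr !sform_alternating add0r addr0 => /eqP.
by rewrite addr_eq0 (oppE (f v u : K^o)) => /eqP.
Qed.

Lemma sb_expand v : v = \sum_i (f v (y i) *: x i + f (x i) v *: y i).
Proof.
pose P v := v = \sum_i (f v (y i) *: x i + f (x i) v *: y i).
have Plin a u w : P u -> P w -> P (a *: u + w).
  move=> Pu Pw; rewrite /P {1}Pu {1}Pw scaler_sumr -big_split /=.
  apply: eq_bigr => i _.
  rewrite linearPl linearPr /= !scalerDl !scalerDr !scalerA.
  by rewrite addrACA.
have P0 : P 0.
  by rewrite /P big1 // => i _; rewrite linear0l linear0r !scale0r addr0.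
have Px j : P (x j).
  rewrite /P (bigD1 j) //= sb_xy sb_xx eqxx scale1r scale0r addr0 big1 ?addr0 //.
  by move=> i ne; rewrite sb_xy sb_xx eq_sym (negPf ne) !scale0r addr0.
have Py j : P (y j).
  rewrite /P (bigD1 j) //= sb_xy sb_yy eqxx scale1r scale0r add0r big1 ?addr0 //.
  by move=> i ne; rewrite sb_xy sb_yy (negPf ne) !scale0r addr0.
have /andP [/eqP span_b _] := sb_basis B.
have : v \in <<[seq x i | i : 'I_m] ++ [seq y i | i : 'I_m]>>%VS.
  by rewrite span_b memvf.
rewrite -[X in <<X>>%VS]/(tval (in_tuple _)) => /coord_span ->.
elim/big_ind: _ => [//|u w Pu Pw|i _].
  by rewrite -[u]scale1r; apply: Plin.
rewrite -[_ *: _]addr0; apply: Plin => //.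
have : (in_tuple ([seq x i | i : 'I_m] ++ [seq y i | i : 'I_m]))`_i \in
   [seq x i | i : 'I_m] ++ [seq y i | i : 'I_m] by exact: mem_nth.
by rewrite mem_cat => /orP [] /mapP [j _ ->].
Qed.

Let beta (u v : V) : DV V := dpow u 1 * dpow v 1.

Let dpow1D (u v : V) : dpow (u + v) 1 = dpow u 1 + dpow v 1.
Proof.
have [c1 _ _ cD] := dpow_compatible V; have := cD u v 1%N.
rewrite /= !big_ord_recl big_ord0 /= => ->; rewrite addr0.
have c0 (w : V) : dpow w 0 = 1 by exact: c1.
rewrite /bump /= !c0.
by rewrite mul1r mulr1 addrC.
Qed.

Let dpow1Z a (v : V) : dpow (a *: v) 1 = a *: dpow v 1.
Proof. by have [_ _ cZ _] := dpow_compatible V; have /= := cZ a v 1%N; rewrite expr1. Qed.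

Let dpow1_0 : dpow (0 : V) 1 = 0.
Proof. by rewrite -[0 in LHS](scale0r 0) dpow1Z scale0r. Qed.

Let betavv v : beta v v = 0.
Proof.
have [_ cM _ _] := dpow_compatible V; rewrite /beta (cM v 1%N 1%N) /=.
by rewrite (pcharf0 char2) scale0r.
Qed.

Lemma dp_act_omega (g : Sp f) : dp_act g omega = omega.
Proof.
pose e (a : 'I_m + 'I_m) := match a with inl i => x i | inr i => y i end.
pose d (a : 'I_m + 'I_m) := match a with inl i => y i | inr i => x i end.
have expand v : v = \sum_a f v (d a) *: e a.
  rewrite big_sumType {1}[v]sb_expand big_split; congr (_ + _).
  by apply: eq_bigr => i _; rewrite sform_sym.
pose M (h : Sp f) a b := \sum_i f (h (x i)) (d a) * f (h (y i)) (d b).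
have actE h : dp_act h omega = \sum_a \sum_b M h a b *: beta (e a) (e b).
  have dpow1_sum v : dpow v 1 = \sum_a f v (d a) *: dpow (e a) 1.
    rewrite {1}[v]expand.
    rewrite (big_morph (fun v => dpow v 1) dpow1D dpow1_0).
    by apply: eq_bigr => a _; rewrite dpow1Z.
  rewrite rmorph_sum; under eq_bigr => i _.
    rewrite rmorphM /= !dp_act_dpow (dpow1_sum (h (x i))) (dpow1_sum (h (y i))).
    rewrite mulr_suml; under eq_bigr => a _ do rewrite mulr_sumr.
    over.
  rewrite exchange_big; apply: eq_bigr => a _ /=.
  rewrite exchange_big; apply: eq_bigr => b _ /=.
  rewrite scaler_suml; apply: eq_bigr => i _.
  by rewrite -scalerAl -scalerAr scalerA.
have symM h a b : M h a b + M h b a = f (d a) (d b).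
  pose p := d a; pose q := d b; pose h' := (h^-1)%g.
  have hK v : h (h' v) = v by exact: lker0_lfunVK (Sp_lker h) v.
  have Dq := sb_expand (h' q).
  have {}Dq : q = \sum_i (f (h (y i)) q *: h (x i) + f (h (x i)) q *: h (y i)).
    rewrite -[q in LHS]hK Dq linear_sum; apply: eq_bigr => i _.
    rewrite linearD !linearZ /= -(Sp_form h (h' q)) -(Sp_form h _ (h' q)) hK.
    by rewrite sform_sym.
  rewrite -/p -/q {1}Dq linear_sumr /M -big_split /=; apply: eq_bigr => i _.
  rewrite linearDr !linearZr /= -/p -/q addrC.
  by rewrite (sform_sym p) (sform_sym p) addrC mulrC.
have E1 : dp_act (1%g : Sp f) omega = omega by exact: dp_act1.
rewrite -[RHS]E1 {E1}.
apply/eqP; rewrite -subr_eq0 !actE -sumrB.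
under eq_bigr => a _ do rewrite -sumrB.
pose N a b := M g a b - M 1%g a b.
have symN a b : N a b = N b a.
  apply/eqP; rewrite /N -(oppE (M g b a - _ : K^o)) -addr_eq0.
  by rewrite addrACA symM -opprD symM subrr.
under eq_bigr => a _ do under eq_bigr => b _ do rewrite -scalerBl -/(N a b).
pose F a b := N a b *: beta (e a) (e b).
have FC a b : F a b = F b a by rewrite /F symN /beta mulrC.
have F0 a : F a a = 0 by rewrite /F betavv scaler0.
rewrite pair_bigA /= -[X in X == _]/(\sum_p F p.1 p.2).
pose r (p : ('I_m + 'I_m) * ('I_m + 'I_m)) :=
  (enum_rank p.1 < enum_rank p.2)%N.
rewrite (bigID r) /=.
rewrite [X in _ + X](bigID (fun p => p.1 == p.2)) /=.
rewrite [X in _ + (X + _)]big1 ?add0r; last first.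
  by move=> [a b] /= /andP [_ /eqP ->].
rewrite [X in _ + X](reindex_inj (h := fun p => (p.2, p.1))) /=; last first.
  by move=> [a b] [a' b'] [-> ->].
rewrite [X in _ + X](eq_big r (fun p => F p.1 p.2)) ?addKK //.
move=> [a b]; rewrite /r /= -leqNgt ltn_neqAle andbC.
by rewrite (inj_eq val_inj) (inj_eq enum_rank_inj) eq_sym.
Qed.

Lemma omega_sq : omega * omega = 0.
Proof.
rewrite -expr2 /omega; elim/big_ind: _ => [|u v|i _]; rewrite ?expr0n //.
  by rewrite sqrrD => -> ->; rewrite add0r addr0 mulr2n addKK.
have x2 : dpow (x i) 1 ^+ 2 = 0 by rewrite expr2; exact: betavv.
by rewrite exprMn x2 mul0r.
Qed.

Fact cocycles_stable k : gstable (M := DV_gmodule f) (cocycles k).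
Proof.
move=> g z; rewrite !cocyclesE => /andP [dz /eqP oz].
apply/andP; split; first exact: (homog_stable (f := f)).
by rewrite -[omega](dp_act_omega g) -rmorphM oz rmorph0.
Qed.

Fact coboundaries_stable k : gstable (M := DV_gmodule f) (coboundaries k).
Proof.
move=> g z /coboundariesP [[_ ->]|[k' [-> [w dw ->]]]].
  by rewrite linear0 coboundaries0.
have -> : gact (M := DV_gmodule f) g (omega * w) = omega * dp_act g w.
  by rewrite -[in RHS](dp_act_omega g) -rmorphM.
by apply: mem_coboundaries; exact: (homog_stable (f := f)).
Qed.

Lemma homogM j k z w :
  z \in homog j -> w \in homog k -> z * w \in homog (V := V) (j + k).
Proof.
move=> /asboolP [s [ds ->]] /asboolP [s' [ds' ->]].
rewrite mulr_suml big_seq; apply: rpred_sum => t ts.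
rewrite mulr_sumr big_seq; apply: rpred_sum => t' ts'.
apply/asboolP; exists [:: (t.1 * t'.1, t.2 ++ t'.2)]; split.
  move=> u; rewrite inE => /eqP -> /=.
  by rewrite /unzip2 map_cat sumn_cat -!/unzip2 ds ?ds'.
by rewrite big_seq1 /dp_monomial big_cat -scalerAl -scalerAr scalerA.
Qed.

Lemma omega_homog : omega \in homog 2.
Proof.
apply: rpred_sum => i _; apply/asboolP.
exists [:: (1, [:: (x i, 1%N); (y i, 1%N)])]; split.
  by move=> t; rewrite inE => /eqP ->.
by rewrite big_seq1 /dp_monomial /= scale1r !big_cons big_nil mulr1.
Qed.

Lemma coboundaries_sub k : {subset coboundaries k <= cocycles k}.
Proof.
move=> z /coboundariesP [[_ ->]|[k' [-> [w dw ->]]]]; first exact: rpred0.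
rewrite cocyclesE mulrA omega_sq mul0r eqxx andbT.
exact: (homogM omega_homog dw).
Qed.

Definition DV_cohomology (k : nat) : gmodule K (Sp f) :=
  subq_gmodule (M := DV_gmodule f) (Z := cocycles k) (B := coboundaries k)
    (@cocycles_stable k) (@coboundaries_stable k).

End Cohomology.

Section HighestWeight.
Variables (K : fieldType) (V : vectType K) (f : symplectic_form V).

(* K[Sp(V)]: the determinant is 1 on Sp(V), so the matrix coefficients
   generate the coordinate ring. *)
Inductive regular_fun : (Sp f -> K) -> Prop :=
| RegCst c : regular_fun (fun=> c)
| RegCoef (phi : {linear V -> K | *%R}) v : regular_fun (fun g => phi (g v))
| RegAdd p q : regular_fun p -> regular_fun q ->
    regular_fun (fun g => p g + q g)
| RegMul p q : regular_fun p -> regular_fun q ->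
    regular_fun (fun g => p g * q g).

(* Locally finite, with regular matrix coefficients. *)
Definition gmod_rational (M : gmodule K (Sp f)) : Prop :=
  forall v : M, exists (n : nat) (w : 'I_n -> M) (c : 'I_n -> Sp f -> K),
    (forall i, regular_fun (c i)) /\
    forall g, gact g v = \sum_i c i g *: w i.

Variables (m : nat) (B : symplectic_basis f m).

(* g is the element of the maximal torus T with eps_i(g) = t i. *)
Definition torus_elt (g : Sp f) (t : 'I_m -> K) : Prop :=
  forall i, [/\ t i != 0, g (sb_x B i) = t i *: sb_x B i
              & g (sb_y B i) = (t i)^-1 *: sb_y B i].

(* lam : 'rV[int]_m stands for the character \sum_i (lam 0 i) eps_i of T. *)
Definition character_eval (lam : 'rV[int]_m) (t : 'I_m -> K) : K :=
  \prod_i t i ^ lam 0 i.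

Definition is_weight (M : gmodule K (Sp f)) (lam : 'rV[int]_m) : Prop :=
  exists2 v : M, v != 0 &
    forall g t, torus_elt g t -> gact g v = character_eval lam t *: v.

Definition eps (i : 'I_m) : 'rV[int]_m := delta_mx 0 i.

(* eps_i - eps_(i+1) for i < m, and 2 eps_m for the last index; indices are
   shifted by one, and the sum below has exactly one term. *)
Definition simple_root (i : 'I_m) : 'rV[int]_m :=
  if i.+1 == m then eps i *+ 2
  else eps i - \sum_(j < m | j == i.+1 :> nat) eps j.

(* mu <= lam: lam - mu is a sum of positive (equivalently simple) roots. *)
Definition weight_le (mu lam : 'rV[int]_m) : Prop :=
  exists n : 'I_m -> nat, lam - mu = \sum_i simple_root i *+ n i.

Definition highest_weight (M : gmodule K (Sp f)) (lam : 'rV[int]_m) : Prop :=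
  is_weight M lam /\ forall mu, is_weight M mu -> weight_le mu lam.

Definition fund_weight (i : nat) : 'rV[int]_m := \sum_(j < m | (j < i)%N) eps j.

(* M is a model of L(lam); a rational module need not be finite-dimensional,
   but an irreducible one is. *)
Definition is_simple_module (lam : 'rV[int]_m) (M : gmodule K (Sp f)) : Prop :=
  [/\ gmod_irreducible M, gmod_rational M & highest_weight M lam].

End HighestWeight.

(* Main.v *)
Require Import Defs.
From HB Require Import structures.
From mathcomp Require Import all_boot all_order fingroup perm all_algebra.
From mathcomp Require Import sesquilinear boolp.
Set Implicit Arguments.
Unset Strict Implicit.
Unset Printing Implicit Defensive.
Import Order.TTheory GRing.Theory Num.Theory.
Local Open Scope ring_scope.

(** Write H for the cohomology in degree m, and d(g) for the determinant of the
    matrix of the f(g x_j, y_i), that is, of the block of g that maps the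
    Lagrangian X spanned by the x_i to itself.

    H is simple of highest weight omega_m.  Contraction with a vector u is the
    derivation of the divided power algebra with v^(a) |-> f(v,u) v^(a-1); in
    characteristic 2 it sends omega to u ([contr_omega]).  Contracting
    omega z = 0 along u and then along v, where f(u,v) = 1, shows that z is
    cohomologous to u (contr v z) + v (contr u z) ([cocycle_homotopy]).
    Applied to the pairs (x_i, y_i) in turn, this rewrites a cocycle of degree m as a
    combination of the 2^m monomials e_1 ... e_m with e_i in {x_i, y_i}: the m
    contractions use up the whole degree, so that the coefficients are scalars
    ([spin_span]).  The coefficients are themselves iterated contractions, and
    they vanish on multiples of omega, so the 2^m classes form a basis of H
    ([spin_coef_coboundary], [spin_class_free]).  The torus acts on them by the
    weights +-eps_1 +- ... +- eps_m, the largest of which is omega_m.  A long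
    root element x_i |-> x_i + y_i or y_i |-> y_i + x_i either fixes a basis
    class or adds to it the class with the i-th sign changed; such elements
    isolate any basis class that occurs in a given vector and then reach all
    the others, whence irreducibility ([spin_irreducible]).

    A simple module L of highest weight omega_m is determined by it.  Let v be
    a vector of weight omega_m in L.  The weights of L are permuted by the
    symmetric group and bounded by omega_m, so their coordinates are at most 1
    ([weight_le1]).  Hence v is fixed by every root element whose root has a
    positive coordinate ([root_fixes]): moving v along the one-parameter group
    would otherwise produce a weight with a coordinate exceeding 1.
    These root elements and the torus generate the stabilizer of X, which
    therefore acts on v through d ([stabilizer_realized],
    [x_unipotent_fixes]).  If d(g) <> 0 then g v = d(g) u v for some u that
    fixes all y_i ([cell_factorization]), and a one-parameter subgroup of the
    torus deforms u v to v.  So a linear relation between vectors g_i v with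
    d(g_i) <> 0 implies the same relation between the d(g_i)
    ([cell_relation]).  The condition d(g_i) <> 0 holds after multiplying by a
    generic element that fixes X pointwise, and both sides are polynomial in
    that element, so it can be dropped ([relation_x_minor]).  Consequently the
    annihilator of v in the group algebra consists of the sums of c_i g_i such
    that the sum of the c_i d(h g_i) is 0 for all h ([annihilator_minor]).
    This does not depend on L, and a module generated by one vector is
    determined by the annihilator of that vector ([cyclic_isomorphic]). *)

(** * Polynomials over an algebraically closed field, and matrices *)

Section Infinite.
Variable K : closedFieldType.

(** A non-constant p + 1 would have a root, at which p takes the value -1. *)
Lemma poly_vanish (p : {poly K}) : (forall t, p.[t] = 0) -> p = 0.
Proof.
move=> p0; have [/closed_rootP[x]|] := boolP (size (p + 1) != 1%N).
  by rewrite rootE hornerD p0 hornerC add0r oner_eq0.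
rewrite negbK => /size_poly1P[c _ Dp].
have Dp' : p = (c - 1)%:P by rewrite polyCB -Dp addrK.
by have := p0 0; rewrite Dp' hornerC => ->; rewrite polyC0.
Qed.

(** Identities need only be checked away from the zeros of a nonzero
    polynomial, because the product p q then vanishes everywhere. *)
Lemma poly_vanish_generic (p q : {poly K}) :
  q != 0 -> (forall t, q.[t] != 0 -> p.[t] = 0) -> p = 0.
Proof.
move=> q0 pq; have /eqP : p * q = 0.
  apply: poly_vanish => t; rewrite hornerM.
  by have [->|/pq ->] := eqVneq q.[t] 0; rewrite ?mulr0 ?mul0r.
by rewrite mulf_eq0 (negPf q0) orbF => /eqP.
Qed.

Lemma poly_nonroot (q : {poly K}) : q != 0 -> exists t, q.[t] != 0.
Proof.
move=> q0; apply: contrapT => noq; case/eqP: q0; apply: poly_vanish => t.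
by apply: contrapT => /eqP qt; apply: noq; exists t.
Qed.

Lemma nonzero_points n : exists2 s : seq K, size s = n & uniq s && (0 \notin s).
Proof.
elim: n => [|n [s <- us]]; first by exists [::].
have p0 : \prod_(a <- 0 :: s) ('X - a%:P) != 0.
  by rewrite monic_neq0 // monic_prod_XsubC.
have [t] := poly_nonroot p0.
rewrite -rootE root_prod_XsubC inE negb_or => /andP[t0 ts].
exists (t :: s) => //=; rewrite ts inE negb_or eq_sym t0.
by case/andP: us => -> ->.
Qed.

(** Lagrange interpolation, by inverting a Vandermonde matrix.  Expressing a
    coefficient through values makes it meaningful for polynomials with
    coefficients in an arbitrary vector space. *)
Lemma coef_interpolation n k : exists a : seq (K * K),
  (forall q, q \in a -> q.2 != 0) /\
  forall p : {poly K}, (size p <= n)%N -> p`_k = \sum_(q <- a) q.1 * p.[q.2].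
Proof.
have [kn|nk] := ltnP k n; last first.
  exists [::]; split=> // p pn; rewrite big_nil nth_default //.
  exact: leq_trans nk.
have [s sz /andP[us s0]] := nonzero_points n.
pose t : 'rV[K]_n := \row_j s`_j; pose W := Vandermonde n t.
have uW : W \in unitmx.
  rewrite unitmxE det_Vandermonde unitfE; apply/prodf_neq0 => i _.
  apply/prodf_neq0 => j lij; rewrite !mxE subr_eq0 nth_uniq ?sz //.
  by rewrite eq_sym neq_ltn lij.
exists [seq (invmx W j (Ordinal kn), s`_j) | j : 'I_n]; split.
  move=> q /mapP[j _ ->] /=; apply: contraNneq s0 => <-.
  by rewrite mem_nth ?sz.
move=> p pn; rewrite big_map big_enum /=.
pose r : 'rV[K]_n := \row_i p`_i.
have rW j : (r *m W) 0 j = p.[s`_j].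
  rewrite (horner_coef_wide _ pn) mxE; apply: eq_bigr => i _.
  by rewrite !mxE.
transitivity (r 0 (Ordinal kn)); first by rewrite mxE.
rewrite -[r in LHS](mulmxK uW) mxE; apply: eq_bigr => j _.
by rewrite rW mulrC.
Qed.

Variable L : lmodType K.

(** A list of pairs (P, w) stands for the vector-valued polynomial
    t |-> sum of P(t) w; this representation does not require the vectors w to
    be independent. *)
Lemma vpoly_coef0 (s : seq ({poly K} * L)) :
  (forall t, t != 0 -> \sum_(q <- s) q.1.[t] *: q.2 = 0) ->
  forall k, \sum_(q <- s) q.1`_k *: q.2 = 0.
Proof.
move=> s0 k; pose n := (\max_(q <- s) size q.1)%N.
have [a [a0 Ha]] := coef_interpolation n k.
have : \sum_(c <- a) c.1 *: (\sum_(q <- s) q.1.[c.2] *: q.2) = 0.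
  by rewrite big_seq big1 // => c /a0 c0; rewrite s0 ?scaler0.
under eq_bigr do rewrite scaler_sumr.
rewrite exchange_big /= => a_s; rewrite -[RHS]a_s.
rewrite big_seq [RHS]big_seq; apply: eq_bigr => q qs.
rewrite Ha; last exact: (leq_bigmax_seq (F := fun q : {poly K} * L => size q.1)).
by rewrite scaler_suml; apply: eq_bigr => c _; rewrite scalerA.
Qed.

(** The specialization used to deform a vector to its limit at t = 0 along
    the torus, where only t <> 0 is available. *)
Lemma vpoly_at0 (s : seq ({poly K} * L)) :
  (forall t, t != 0 -> \sum_(q <- s) q.1.[t] *: q.2 = 0) ->
  \sum_(q <- s) q.1.[0] *: q.2 = 0.
Proof.
move=> /vpoly_coef0/(_ 0%N) {2}<-; apply: eq_bigr => q _.
by rewrite horner_coef0.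
Qed.

End Infinite.

Section Matrices.
Variable K : fieldType.

(** The rows of (A | C) span a Lagrangian, and the lemma provides a Lagrangian
    graph transverse to it.  Writing A = L P R with P a partial identity,
    take Q = R^T (1 - P) R: a row u killed by A + C Q is killed by A, because
    (1 - P) P = 0, and the symmetry of A C^T then forces u C = 0 as well. *)
Lemma symmetric_transversal n (A C : 'M[K]_n) :
  A *m C^T = C *m A^T ->
  (forall u : 'rV_n, u *m A = 0 -> u *m C = 0 -> u = 0) ->
  exists2 Q : 'M_n, Q^T = Q & \det (A + C *m Q) != 0.
Proof.
move=> AC inj; pose r := \rank A; pose R := row_ebase A.
pose P : 'M[K]_n := pid_mx r; pose J : 'M[K]_n := copid_mx r.
have PP : P *m P = P by rewrite pid_mx_id ?rank_leq_row.
have JP : J *m P = 0 by rewrite /J /copid_mx mulmxBl mul1mx PP subrr.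
have DA : A = col_ebase A *m P *m R by rewrite mulmx_ebase.
have trP : P^T = P by rewrite tr_pid_mx.
have trJ : J^T = J by rewrite /J /copid_mx linearB /= trmx1 trP.
have uR : R \in unitmx by exact: row_ebase_unit.
exists (R^T *m J *m R); first by rewrite !trmx_mul trmxK trJ mulmxA.
suff : A + C *m (R^T *m J *m R) \in unitmx by rewrite unitmxE unitfE.
have -> : A + C *m (R^T *m J *m R) =
    (col_ebase A *m P + C *m R^T *m J) *m R by rewrite mulmxDl -DA !mulmxA.
rewrite unitmx_mul uR andbT -row_free_unit -kermx_eq0.
apply/eqP/row_matrixP => i; rewrite row0; set u := row i _.
have : u *m (col_ebase A *m P + C *m R^T *m J) = 0.
  by rewrite -row_mul mulmx_ker row0.
rewrite mulmxDr !mulmxA => u0.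
have u1 : u *m col_ebase A *m P = 0.
  have := congr1 (mulmx^~ P) u0.
  by rewrite /= mulmxDl -!mulmxA JP PP !mulmx0 addr0 mul0mx !mulmxA.
have uA : u *m A = 0 by rewrite DA !mulmxA u1 mul0mx.
have u2 : u *m C *m R^T *m J = 0 by move: u0; rewrite u1 add0r.
apply: (inj u uA).
have uCP : u *m C *m R^T *m P = 0.
  have := congr1 (mulmx u) AC; rewrite mulmxA uA mul0mx [in X in _ = X -> _]DA.
  rewrite !trmx_mul trP !mulmxA => /esym/(congr1 (mulmx^~ (invmx (col_ebase A)^T))).
  by rewrite /= mulmxK ?mul0mx // unitmx_tr col_ebase_unit.
have uCR : u *m C *m R^T = 0.
  by rewrite -[LHS]mulmx1 -(subrK P 1%:M) mulmxDr uCP addr0.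
have uRT : R^T \in unitmx by rewrite unitmx_tr.
by rewrite -[LHS](mulmxK uRT) uCR mul0mx.
Qed.

(** Gaussian elimination by column operations: the invertible matrices are
    generated by the diagonal ones and the matrices that add a combination of
    the other basis vectors to one basis vector.  The rows are brought one
    after the other to the rows of the identity. *)
Lemma unitmx_elementary_ind n (Pr : 'M[K]_n -> Prop) :
  (forall A B, Pr A -> Pr B -> Pr (A *m B)) ->
  (forall d : 'rV_n, (forall i, d 0 i != 0) -> Pr (diag_mx d)) ->
  (forall k (b : 'rV_n), b 0 k = 0 -> Pr (1%:M + delta_mx k 0 *m b)) ->
  forall A, A \in unitmx -> Pr A.
Proof.
move=> PrM PrD PrE.
have Edelta i k (b : 'rV[K]_n) :
    delta_mx 0 i *m (delta_mx k 0 *m b) = (i == k)%:R *: b :> 'rV_n.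
  rewrite mulmxA mul_delta_mx_cond; case: eqP => _.
    rewrite mulr1n scale1r; apply/rowP => j.
    by rewrite mxE big_ord1 mxE !eqxx mul1r.
  by rewrite mulr0n mul0mx scale0r.
have Einv k (b : 'rV_n) : b 0 k = 0 ->
    (1%:M + delta_mx k 0 *m b) *m (1%:M + delta_mx k 0 *m (- b)) = 1%:M :> 'M[K]_n.
  move=> bk; rewrite mulmxDr mulmx1 mulmxDl mul1mx mulmxN addrA.
  have bd : b *m delta_mx k 0 = 0 :> 'M_1.
    by rewrite -colE; apply/matrixP=> i j; rewrite !ord1 !mxE.
  have -> : delta_mx k 0 *m b *m - (delta_mx k 0 *m b) = 0.
    by rewrite mulmxN mulmxA -(mulmxA _ b) bd mulmx0 mul0mx oppr0.
  by rewrite addr0 addrK.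
have PrE' k (b : 'rV_n) A : b 0 k = 0 ->
    Pr (A *m (1%:M + delta_mx k 0 *m b)) -> Pr A.
  move=> bk PA; rewrite -[A]mulmx1 -(Einv k b bk) mulmxA; apply: PrM => //.
  by apply: PrE; rewrite mxE bk oppr0.
have PrD' (d : 'rV_n) A : (forall i, d 0 i != 0) ->
    Pr (A *m diag_mx d) -> Pr A.
  move=> d0 PA; pose d' : 'rV_n := \row_i (d 0 i)^-1.
  have dd : diag_mx d *m diag_mx d' = 1%:M.
    rewrite mulmx_diag; apply/matrixP => i j; rewrite !mxE.
    by case: eqP => // _; rewrite mulfV.
  rewrite -[A]mulmx1 -dd mulmxA; apply: PrM => //; apply: PrD => i.
  by rewrite mxE invr_eq0.
have Eunit k (b : 'rV_n) : b 0 k = 0 ->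
    (1%:M + delta_mx k 0 *m b : 'M[K]_n) \in unitmx.
  by move=> bk; case/mulmx1_unit: (Einv k b bk).
(* r counts the rows that are not yet those of the identity. *)
suff H r : (r <= n)%N -> forall A, A \in unitmx ->
    (forall i : 'I_n, (i < n - r)%N -> row i A = delta_mx 0 i) -> Pr A.
  by move=> A uA; apply: (H n) => // i; rewrite subnn.
elim: r => [_ A uA|r IH rn A uA].
  rewrite subn0 => rA; have -> : A = diag_mx (const_mx 1).
    apply/row_matrixP => i; rewrite diag_const_mx (rA i (ltn_ord i)).
    by rewrite rowE mulmx1.
  by apply: PrD => i; rewrite mxE oner_eq0.
move=> rA; have kn : (n - r.+1 < n)%N by rewrite ltn_subrL /= (leq_trans _ rn).
pose k := Ordinal kn.
have nrk : (n - r = k.+1)%N by rewrite /= subnS prednK // subn_gt0.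
have reduce1 B : B \in unitmx ->
    (forall i : 'I_n, (i < n - r.+1)%N -> row i B = delta_mx 0 i) ->
    B k k != 0 -> Pr B.
  move=> uB rB Bk0.
  pose d : 'rV_n := \row_i (if i == k then (B k k)^-1 else 1).
  have d0 i : d 0 i != 0.
    by rewrite mxE; case: (i == k); rewrite ?invr_eq0 ?oner_eq0.
  apply: (PrD' d) => //; set B1 := B *m _.
  have uB1 : B1 \in unitmx.
    by rewrite unitmx_mul uB unitmxE det_diag unitfE; apply/prodf_neq0.
  have rB1 (i : 'I_n) : (i < k)%N -> row i B1 = delta_mx 0 i.
    move=> ik; rewrite row_mul rB //; apply/rowP => j.
    rewrite mul_mx_diag !mxE eqxx /=; 
    case: (eqVneq j i) => [->|_]; last by rewrite mul0r.
    by rewrite mul1r -val_eqE /= ltn_eqF.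
  have B1k : B1 k k = 1 by rewrite /B1 mul_mx_diag !mxE eqxx mulfV.
  clearbody B1.
  pose b : 'rV_n := delta_mx 0 k - row k B1.
  have bk : b 0 k = 0 by rewrite !mxE B1k !eqxx subrr.
  apply: (PrE' k b) => //; apply: IH; first exact: ltnW.
    by rewrite unitmx_mul uB1 Eunit.
  move=> i; rewrite nrk ltnS leq_eqVlt => /predU1P[ik|ik].
    have -> : i = k by exact: val_inj.
    rewrite row_mul mulmxDr mulmx1 mulmxA -colE.
    have -> : col k (row k B1) = 1%:M.
      by apply/matrixP=> u v; rewrite !ord1 !mxE B1k.
    by rewrite mul1mx addrC subrK.
  rewrite row_mul rB1 // mulmxDr mulmx1 Edelta.
  by rewrite -val_eqE /= ltn_eqF // scale0r addr0.
have [Ak0|] := eqVneq (A k k) 0; last exact: reduce1.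
(* Otherwise row k is a combination of the previous rows. *)
have [j Akj jk] : exists2 j : 'I_n, A k j != 0 & (k <= j)%N.
  apply: contrapT => noj.
  pose u : 'rV_n := delta_mx 0 k - \row_j (if (j < k)%N then A k j else 0).
  have uA0 : u *m A = 0.
    rewrite mulmxBl -rowE; apply/eqP; rewrite subr_eq0; apply/eqP/rowP => j.
    rewrite mulmx_sum_row summxE (eq_bigr (fun i => A k i *+ (j == i))); last first.
      move=> i _; rewrite !mxE; case: ltnP => [ik|ki].
        have := rA i ik => /rowP/(_ j); rewrite !mxE eqxx /= => ->.
        by rewrite mulr_natr.
      have -> : A k i = 0.
        by apply: contrapT => /eqP Aki; apply: noj; exists i.
      by rewrite mul0r mul0rn.
    rewrite (bigD1 j) //= eqxx big1 ?addr0 ?mxE // => i.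
    by rewrite eq_sym => /negPf ->.
  have : u = 0 by rewrite -[u](mulmxK uA) uA0 mul0mx.
  by move/rowP/(_ k); rewrite !mxE !eqxx ltnn subr0 => /eqP; rewrite oner_eq0.
have jneqk : j != k by apply: contraNneq Akj => ->; rewrite Ak0.
(* Adding column j to column k makes the pivot nonzero. *)
pose b : 'rV[K]_n := delta_mx 0 k.
have bj : b 0 j = 0 by rewrite mxE (negPf jneqk).
apply: (PrE' j b) => //; apply: reduce1.
- by rewrite unitmx_mul uA Eunit.
- move=> i ik; rewrite row_mul rA // mulmxDr mulmx1 Edelta.
  have -> : (i == j) = false by rewrite -val_eqE /= ltn_eqF // (leq_trans ik).
  by rewrite scale0r addr0.
- rewrite mulmxDr mulmx1 mxE Ak0 add0r mulmxA -colE mxE big_ord1 !mxE eqxx.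
  by rewrite mulr1.
Qed.

End Matrices.

(** * Contractions of the divided power algebra *)

Section DualNumbers.
Variables (K : fieldType) (A : comAlgType K).

(** The ring A[e]/(e^2), where (a, b) stands for a + b e.  A derivation of B
    with values in A is the same as an algebra morphism from B to A[e]/(e^2)
    that lifts a morphism from B to A. *)
Definition dual_numbers : Type := (A * A)%type.

HB.instance Definition _ := GRing.Lmodule.on dual_numbers.

Definition dual_one : dual_numbers := (1, 0).
Definition dual_mul (p q : dual_numbers) : dual_numbers :=
  (p.1 * q.1, p.1 * q.2 + p.2 * q.1).

Fact dual_mulA : associative dual_mul.
Proof.
move=> [a a'] [b b'] [c c']; rewrite /dual_mul /= mulrA; congr (_, _).
by rewrite mulrDl mulrDr !mulrA addrA.
Qed.
Fact dual_mulC : commutative dual_mul.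
Proof.
move=> [a a'] [b b']; rewrite /dual_mul /= mulrC addrC; congr (_, _).
by rewrite (mulrC a') (mulrC a).
Qed.
Fact dual_mul1 : left_id dual_one dual_mul.
Proof. by move=> [a a']; rewrite /dual_mul /= !mul1r mul0r addr0. Qed.
Fact dual_mulDl : left_distributive dual_mul +%R.
Proof.
by move=> [a a'] [b b'] [c c']; congr (_, _); rewrite /= !mulrDl // addrACA.
Qed.
Fact dual_one_neq0 : dual_one != 0.
Proof. by apply/eqP => -[/eqP]; rewrite oner_eq0. Qed.

HB.instance Definition _ := GRing.Zmodule_isComNzRing.Build dual_numbers
  dual_mulA dual_mulC dual_mul1 dual_mulDl dual_one_neq0.

Fact dual_scaleAl (a : K) (p q : dual_numbers) :
  a *: dual_mul p q = dual_mul (a *: p) q.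
Proof.
apply: injective_projections => /=; first exact: scalerAl.
by rewrite scalerDr !scalerAl.
Qed.
HB.instance Definition _ :=
  GRing.Lmodule_isLalgebra.Build K dual_numbers dual_scaleAl.
HB.instance Definition _ := GRing.Lalgebra_isComAlgebra.Build K dual_numbers.

Definition dual_body (p : dual_numbers) : A := p.1.

Fact dual_body_zmod : zmod_morphism dual_body. Proof. by []. Qed.
HB.instance Definition _ :=
  GRing.isZmodMorphism.Build dual_numbers A dual_body dual_body_zmod.
Fact dual_body_monoid : monoid_morphism dual_body. Proof. by []. Qed.
HB.instance Definition _ :=
  GRing.isMonoidMorphism.Build dual_numbers A dual_body dual_body_monoid.
Fact dual_body_scalable : scalable dual_body. Proof. by []. Qed.
HB.instance Definition _ :=
  GRing.isScalable.Build K dual_numbers A *:%R dual_body dual_body_scalable.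

End DualNumbers.

Section Contraction.
Variables (K : fieldType) (V : vectType K) (f : symplectic_form V).

Notation D := (DV V).

Lemma dpow0 (v : V) : dpow v 0 = 1.
Proof. by have [c1 _ _ _] := dpow_compatible V; apply: c1. Qed.

Lemma dpowM (v : V) a b : dpow v a * dpow v b = 'C(a + b, a)%:R *: dpow v (a + b).
Proof. by have [_ cM _ _] := dpow_compatible V; apply: cM. Qed.

Lemma dpowZ t (v : V) a : dpow (t *: v) a = t ^+ a *: dpow v a.
Proof. by have [_ _ cZ _] := dpow_compatible V; apply: cZ. Qed.

Lemma dpowD (u v : V) a :
  dpow (u + v) a = \sum_(i < a.+1) dpow u i * dpow v (a - i).
Proof. by have [_ _ _ cD] := dpow_compatible V; apply: cD. Qed.

(** v^(a-1), with the convention v^(-1) = 0. *)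
Definition dpow_pred (v : V) (a : nat) : D :=
  if a is a'.+1 then dpow v a' else 0.

Fact contraction_compatible (u : V) : dp_compatible (fun p : V * nat =>
  (dpow p.1 p.2, f p.1 u *: dpow_pred p.1 p.2) : dual_numbers D).
Proof.
split=> [v|v a b|t v a|v w a] /=.
- by rewrite dpow0 scaler0.
- apply: injective_projections => /=; rewrite ?dpowM //=.
  rewrite -!scalerAl -!scalerAr -scalerDr.
  rewrite [RHS]scalerA [X in _ = X *: _]mulrC -[RHS]scalerA.
  congr (_ *: _); case: a => [|a] /=.
    by rewrite dpow0 mul0r mul1r addr0 add0n bin0 scale1r.
  case: b => [|b] /=.
    by rewrite dpow0 mulr0 mulr1 add0r !addn0 binn scale1r.
  by rewrite !dpowM addSnnS -scalerDl -natrD; congr (_%:R *: _).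
- apply: injective_projections => /=; rewrite ?dpowZ //= linearZl_LR /= !scalerA.
  case: a => [|a] /=; rewrite ?scaler0 // dpowZ scalerA exprS.
  by congr (_ *: _); rewrite mulrAC.
- apply: injective_projections => /=.
    by rewrite (big_morph (fun p : dual_numbers D => p.1) (id1 := 0) (op1 := +%R)) // dpowD.
  rewrite (big_morph (fun p : dual_numbers D => p.2) (id1 := 0) (op1 := +%R)) //=.
  rewrite big_split /= linearDl scalerDl [LHS]addrC; congr (_ + _).
    case: a => [|a] /=.
      by rewrite big_ord1 /= !scaler0 mulr0.
    rewrite big_ord_recr /= subnn /= scaler0 mulr0 addr0 dpowD scaler_sumr.
    apply: eq_bigr => i _; rewrite subSn /= ?scalerAr //.
    by rewrite -ltnS ltn_ord.
  case: a => [|a] /=.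
    by rewrite big_ord1 /= !scaler0 mul0r.
  rewrite big_ord_recl /= scaler0 mul0r add0r dpowD scaler_sumr.
  by apply: eq_bigr => i _; rewrite scalerAl.
Qed.

(** Contraction with u: the derivation v^(a) |-> f(v,u) v^(a-1), obtained as
    the coefficient of e in the morphism v^(a) |-> v^(a) + f(v,u) v^(a-1) e. *)
Definition contr (u : V) (z : D) : D := (DV_lift (contraction_compatible u) z).2.

Lemma contraction_body u z : (DV_lift (contraction_compatible u) z).1 = z.
Proof.
apply: (DV_ext (phi := @dual_body K D \o DV_lift (contraction_compatible u))
  (psi := idfun)) => v a /=.
by rewrite DV_lift_dpow.
Qed.

Fact contr_linear u : linear (contr u).
Proof. by move=> a z w; rewrite /contr linearP. Qed.
HB.instance Definition _ u := GRing.isLinear.Build K D D *:%R (contr u) (contr_linear u).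

Lemma contrM u z w : contr u (z * w) = z * contr u w + contr u z * w.
Proof. by rewrite /contr rmorphM /= !contraction_body. Qed.

Lemma contr_dpow u v a : contr u (dpow v a.+1) = f v u *: dpow v a.
Proof. by rewrite /contr DV_lift_dpow. Qed.

Lemma contr1 u : contr u 1 = 0.
Proof. by rewrite /contr rmorph1. Qed.

End Contraction.

(** * Coordinate Lagrangian frames and shears *)

Lemma char2_double (K : fieldType) (char2 : 2%N \in [pchar K])
  (M : lmodType K) (v : M) : v + v = 0.
Proof. by rewrite -mulr2n -scaler_nat (pcharf0 char2) scale0r. Qed.

Lemma char2_opp (K : fieldType) (char2 : 2%N \in [pchar K])
  (M : lmodType K) (v : M) : - v = v.
Proof. by apply/eqP; rewrite eq_sym -addr_eq0 char2_double. Qed.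

Section Frames.
Variables (K : fieldType) (V : vectType K) (f : symplectic_form V) (m : nat).
Variables (B : symplectic_basis f m) (char2 : 2%N \in [pchar K]).

Notation x := (sb_x B).
Notation y := (sb_y B).
Let fC := sform_sym f char2.

(** The coordinate Lagrangian with basis e_1, ..., e_m, e_i being x_i or y_i
    according to a sign.  The opposite signs give the dual Lagrangian. *)
Definition frame (s : 'I_m -> bool) (i : 'I_m) : V := if s i then x i else y i.

Lemma form_frame s t i j :
  f (frame s i) (frame t j) = ((i == j) && (s i != t i))%:R.
Proof.
rewrite /frame; case: (eqVneq i j) => [<-|ij] /=; case: (s i); case: (t _);
  rewrite ?sb_xx ?sb_yy ?sb_xy // ?(fC (y i)) ?sb_xy ?eqxx // 1?eq_sym.
  by rewrite eq_sym (negPf ij).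
by rewrite (negPf ij).
Qed.

Lemma lfun_frame_eq (g h : 'End(V)) :
  (forall i, g (x i) = h (x i)) -> (forall i, g (y i) = h (y i)) -> g = h.
Proof.
move=> gx gy; apply/lfunP => v; rewrite [v](sb_expand B) !linear_sum.
by apply: eq_bigr => i _; rewrite !linearD !linearZ /= gx gy.
Qed.

Lemma Sp_frame_eq (g h : Sp f) :
  (forall i, g (x i) = h (x i)) -> (forall i, g (y i) = h (y i)) -> g = h.
Proof. by move=> gx gy; apply: val_inj; apply: lfun_frame_eq. Qed.

Lemma isometry_symplectic (g : 'End(V)) :
  (forall u v, f (g u) (g v) = f u v) -> is_symplectic_aut f g.
Proof.
move=> gf; apply/andP; split; last exact/asboolP.
apply/lker0P => u v guv; apply/eqP; rewrite -subr_eq0; apply/eqP.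
apply: (sform_nondegenerate (s := f)) => w; rewrite -gf [g _]linearB /= guv subrr.
exact: linear0l.
Qed.

Lemma frame_sp (X Y : 'I_m -> V) :
  (forall i j, f (X i) (X j) = 0) -> (forall i j, f (Y i) (Y j) = 0) ->
  (forall i j, f (X i) (Y j) = (i == j)%:R) ->
  exists g : Sp f, forall i, g (x i) = X i /\ g (y i) = Y i.
Proof.
move=> XX YY XY.
pose h v := \sum_i (f v (y i) *: X i + f (x i) v *: Y i).
have h_lin : linear h.
  move=> a u w; rewrite /h scaler_sumr -big_split /=; apply: eq_bigr => i _.
  rewrite linearPl linearPr /= !scalerDl !scalerDr !scalerA.
  by rewrite addrACA.
pose hM := GRing.isLinear.Build _ _ _ _ h h_lin.
pose hL : {linear V -> V} := HB.pack h hM.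
have hE v : linfun hL v = h v by rewrite lfunE.
have hX u j : f (h u) (X j) = f (x j) u.
  rewrite /h linear_sumlz (bigD1 j) //= linearDl !linearZl_LR /= XX (fC (Y j)) XY.
  rewrite eqxx mulr0 mulr1 add0r big1 ?addr0 // => i ij.
  by rewrite linearDl !linearZl_LR /= XX (fC (Y i)) XY eq_sym (negPf ij) !mulr0 addr0.
have hY u j : f (h u) (Y j) = f u (y j).
  rewrite /h linear_sumlz (bigD1 j) //= linearDl !linearZl_LR /= YY XY.
  rewrite eqxx mulr0 mulr1 addr0 big1 ?addr0 // => i ij.
  by rewrite linearDl !linearZl_LR /= YY XY (negPf ij) !mulr0 addr0.
have hf u v : f (linfun hL u) (linfun hL v) = f u v.
  rewrite !hE {2}/h linear_sumr [in RHS](sb_expand B v) linear_sumr.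
  apply: eq_bigr => i _; rewrite !linearDr !linearZr_LR /= hX hY.
  by rewrite (fC u (x i)).
exists (MkSp (isometry_symplectic hf)) => i /=; rewrite !hE /h; split.
  rewrite (bigD1 i) //= sb_xy sb_xx eqxx scale1r scale0r addr0 big1 ?addr0 //.
  by move=> j ji; rewrite sb_xy sb_xx eq_sym (negPf ji) !scale0r addr0.
rewrite (bigD1 i) //= sb_xy sb_yy eqxx scale1r scale0r add0r big1 ?addr0 //.
by move=> j ji; rewrite sb_xy sb_yy (negPf ji) !scale0r addr0.
Qed.

(** The unipotent map attached to a coordinate Lagrangian and a quadratic form
    on it; it is symplectic when Q is symmetric.  With Q supported on one or
    two entries these are the root elements of Sp(V). *)
Definition shear_map (s : 'I_m -> bool) (Q : 'M[K]_m) (v : V) : V :=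
  v + \sum_i \sum_j (Q i j * f v (frame s i)) *: frame s j.

Fact shear_linear s Q : linear (shear_map s Q).
Proof.
move=> a u w; rewrite /shear_map scalerDr addrACA; congr (_ + _).
rewrite scaler_sumr -big_split /=; apply: eq_bigr => i _.
rewrite scaler_sumr -big_split /=; apply: eq_bigr => j _.
by rewrite linearPl /= mulrDr scalerDl scalerA mulrCA.
Qed.
HB.instance Definition _ s Q :=
  GRing.isLinear.Build K V V *:%R (shear_map s Q) (shear_linear s Q).

(** Total in Q, so that sums and multiples of Q need no proof arguments; the
    value is the identity when the map is not symplectic. *)
Definition shear (s : 'I_m -> bool) (Q : 'M[K]_m) : Sp f :=
  insubd (1%g : Sp f) (linfun (shear_map s Q)).

Lemma shear_symplectic s Q : Q^T = Q -> is_symplectic_aut f (linfun (shear_map s Q)).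
Proof.
move=> sQ; apply: isometry_symplectic => u v; rewrite !lfunE /= /shear_map.
rewrite !linearDl !linearDr /= -[RHS]addr0 -addrA; congr (_ + _).
have N2 w t : f (\sum_i \sum_j (Q i j * f w (frame s i)) *: frame s j)
   (\sum_i \sum_j (Q i j * f t (frame s i)) *: frame s j) = 0.
  rewrite linear_sumlz big1 // => i _; rewrite linear_sumlz big1 // => j _.
  rewrite linear_sumr big1 // => k _; rewrite linear_sumr big1 // => l _.
  by rewrite linearZl_LR linearZr_LR /= form_frame eqxx andbF !mulr0.
rewrite N2 addr0.
have -> : f u (\sum_i \sum_j (Q i j * f v (frame s i)) *: frame s j) =
   f (\sum_i \sum_j (Q i j * f u (frame s i)) *: frame s j) v.
  rewrite linear_sumlz linear_sumr.
  under eq_bigr do rewrite linear_sumr.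
  rewrite exchange_big; apply: eq_bigr => i _; rewrite linear_sumlz.
  apply: eq_bigr => j _; rewrite linearZl_LR linearZr_LR /= -{1}sQ mxE.
  by rewrite (fC v) mulrAC.
exact: (char2_double char2 (_ : K^o)).
Qed.

Lemma shearE s Q v : Q^T = Q -> shear s Q v = shear_map s Q v.
Proof. by move=> sQ; rewrite /shear insubdK ?lfunE //; exact: shear_symplectic. Qed.

Lemma shear_frame s Q j : Q^T = Q -> shear s Q (frame s j) = frame s j.
Proof.
move=> sQ; rewrite shearE // /shear_map big1 ?addr0 // => i _.
by rewrite big1 // => k _; rewrite form_frame eqxx andbF mulr0 scale0r.
Qed.

Lemma shear_coframe s Q j : Q^T = Q ->
  shear s Q (frame (negb \o s) j) =
    frame (negb \o s) j + \sum_k Q j k *: frame s k.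
Proof.
move=> sQ; rewrite shearE // /shear_map; congr (_ + _).
rewrite (bigD1 j) //= [X in _ + X]big1 ?addr0 => [|i ij].
  apply: eq_bigr => k _; rewrite form_frame eqxx /=.
  by case: (s j); rewrite mulr1.
by rewrite big1 // => k _; rewrite form_frame eq_sym (negPf ij) mulr0 scale0r.
Qed.

Lemma frame_sp_eq s (g h : Sp f) :
  (forall i, g (frame s i) = h (frame s i)) ->
  (forall i, g (frame (negb \o s) i) = h (frame (negb \o s) i)) -> g = h.
Proof.
move=> gs gn; apply: Sp_frame_eq => i; have := gs i; have := gn i;
  by rewrite /frame /=; case: (s i).
Qed.

Lemma shearD s Q R : Q^T = Q -> R^T = R ->
  shear s (Q + R) = (shear s Q * shear s R)%g.
Proof.
move=> sQ sR; have sQR : (Q + R)^T = Q + R by rewrite linearD /= sQ sR.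
apply: (frame_sp_eq (s := s)) => i; rewrite comp_lfunE.
  by rewrite !shear_frame.
rewrite !shear_coframe // linearD /= shear_coframe // -addrA; congr (_ + _).
rewrite linear_sum -big_split /=; apply: eq_bigr => k _.
by rewrite linearZ /= shear_frame // mxE scalerDl.
Qed.

Lemma shear0 s : shear s 0 = 1%g.
Proof.
apply: (frame_sp_eq (s := s)) => i; rewrite id_lfunE ?shear_frame ?trmx0 //.
rewrite shear_coframe ?trmx0 // big1 ?addr0 // => k _.
by rewrite mxE scale0r.
Qed.

End Frames.

(** * Cocycles of degree m *)

Section Vectors.
Variables (K : fieldType) (V : vectType K).

Lemma dpow1D (u v : V) : dpow (u + v) 1 = dpow u 1 + dpow v 1.
Proof.
by rewrite dpowD big_ord_recl big_ord1 /= !dpow0 mul1r mulr1 addrC.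
Qed.

Lemma dpow1Z a (v : V) : dpow (a *: v) 1 = a *: dpow v 1.
Proof. by rewrite dpowZ expr1. Qed.

Lemma dpow1_sum (I : Type) (r : seq I) (F : I -> V) :
  dpow (\sum_(i <- r) F i) 1 = \sum_(i <- r) dpow (F i) 1.
Proof.
apply: (big_morph (fun v => dpow v 1) dpow1D).
by rewrite -[0 in LHS](scale0r 0) dpow1Z scale0r.
Qed.

(** The projection onto D_0 V = K. *)
Definition augmentation : {lrmorphism DV V -> K^o} :=
  DV_lift (augmentation_compatible V).

Lemma augmentation_dpow v a : augmentation (dpow v a) = (a == 0%N)%:R.
Proof. by rewrite DV_lift_dpow. Qed.

Lemma homog0_cst (z : DV V) : z \in homog 0 -> z = augmentation z *: 1.
Proof.
case/asboolP => s [s0 ->]; rewrite linear_sum scaler_suml big_seq [RHS]big_seq.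
apply: eq_bigr => t /s0 t0; rewrite linearZ /= -scalerA; congr (_ *: _).
have {t0}-> : dp_monomial t.2 = 1.
  move: t.2 t0; elim=> [|[v a] r IH] /=; first by rewrite /dp_monomial big_nil.
  move/eqP; rewrite addn_eq0 => /andP[/eqP -> /eqP/IH].
  by rewrite /dp_monomial big_cons dpow0 mul1r.
by rewrite rmorph1 scale1r.
Qed.

End Vectors.

Section Homology.
Variables (K : fieldType) (V : vectType K) (f : symplectic_form V) (m : nat).
Variables (B : symplectic_basis f m) (char2 : 2%N \in [pchar K]).

Notation D := (DV V).
Notation x := (sb_x B).
Notation y := (sb_y B).
Notation om := (omega B).
Notation frame := (frame B).
Notation contr := (contr f).
Let fC := sform_sym f char2.

Lemma contr_vector u v : contr u (dpow v 1) = (f v u)%:A.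
Proof. by rewrite contr_dpow dpow0. Qed.

Lemma contr_vectorM u v z :
  contr u (dpow v 1 * z) = dpow v 1 * contr u z + f v u *: z.
Proof. by rewrite contrM contr_vector mulr_algl. Qed.

(** The case of a monomial with a factor of positive degree followed by factors
    of degree 0 needs that contraction kills constants. *)
Lemma contr_homog u k z : z \in homog k.+1 -> contr u z \in homog k.
Proof.
case/asboolP => s [sk ->]; rewrite linear_sum big_seq; apply: rpred_sum => t.
move=> /sk; rewrite linearZ /= => tk; apply: rpredZ; move: t.2 tk {sk} => {}t tk.
have mono r : dp_monomial r \in homog (V := V) (sumn (unzip2 r)).
  apply/asboolP; exists [:: (1, r)]; split; last by rewrite big_seq1 scale1r.
  by move=> q; rewrite inE => /eqP ->.
have mono1 (v : V) a : dpow v a \in homog a.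
  have -> : dpow v a = dp_monomial [:: (v, a)] by rewrite /dp_monomial big_seq1.
  by rewrite -[a in homog a]addn0; exact: (mono [:: (v, a)]).
elim: t k tk => [|[v a] r IH] k //=.
rewrite /dp_monomial big_cons -/(dp_monomial r).
case: a => [|a]; first by rewrite dpow0 mul1r => /IH.
rewrite addSn => -[<-]; rewrite contrM /= contr_dpow; apply: rpredD; last first.
  by apply: homogM => //; apply: rpredZ.
have IHr := IH; case E : (sumn (unzip2 r)) (IHr) => [|b] /= {}IHr; last first.
  by rewrite addnS -addSn; apply: homogM => //; apply: IHr.
suff -> : contr u (dp_monomial r) = 0 by rewrite mulr0 rpred0.
have Hr : dp_monomial r \in homog (V := V) 0 by rewrite -E.
by rewrite (homog0_cst Hr) linearZ /= contr1 scaler0.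
Qed.

(** The expansion of u in the symplectic basis; the signs agree because f is
    symmetric in characteristic 2. *)
Lemma contr_omega u : contr u om = dpow u 1.
Proof.
rewrite linear_sum /= [in RHS](sb_expand B u) dpow1_sum; apply: eq_bigr => i _.
rewrite contr_vectorM contr_vector dpow1D !dpow1Z -scalerAr mulr1.
by rewrite (fC u) addrC.
Qed.

(** Expand the double contraction of omega z = 0 by the Leibniz rule: the two
    contractions hit omega and z in all four ways, and once both have hit omega
    the scalar f(u,v) = 1 remains in front of z. *)
Lemma cocycle_homotopy u v z : f u v = 1 -> om * z = 0 ->
  dpow u 1 * contr v z + dpow v 1 * contr u z = z + om * contr v (contr u z).
Proof.
move=> uv oz; have /(congr1 (contr v)) := congr1 (contr u) oz.
rewrite !linear0 contrM contr_omega linearD /= contrM contr_omega.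
rewrite contr_vectorM uv scale1r => e0.
apply/eqP; rewrite -subr_eq0 (char2_opp char2) -[X in _ == X]e0.
rewrite [X in X == _]addrC [X in X == _]addrACA [X in X == _]addrC.
by rewrite [X in _ + X == _]addrC.
Qed.

Definition frame_monomial (r : seq 'I_m) (s : 'I_m -> bool) : D :=
  \prod_(i <- r) dpow (frame s i) 1.

(** Contraction along the dual frame, which takes the coefficient of
    the frame monomial with signs s. *)
Definition frame_contr (r : seq 'I_m) (s : 'I_m -> bool) (z : D) : D :=
  foldl (fun w i => contr (frame (negb \o s) i) w) z r.

Fact frame_contr_linear r s : linear (frame_contr r s).
Proof.
elim: r => [|i r IH] a z w; first by [].
by rewrite /frame_contr /= linearP -!/(frame_contr _ _ _) IH.
Qed.
HB.instance Definition _ r s :=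
  GRing.isLinear.Build K D D *:%R (frame_contr r s) (frame_contr_linear r s).

Lemma frame_contr_isotropic r s i z :
  frame_contr r s (dpow (frame (negb \o s) i) 1 * z) =
  dpow (frame (negb \o s) i) 1 * frame_contr r s z.
Proof.
elim: r z => //= j r IH z; rewrite contr_vectorM form_frame // eqxx andbF.
by rewrite scale0r addr0 IH.
Qed.

(** Contracting omega z either leaves omega in front or replaces omega by a
    vector of the dual frame.  Since that frame is isotropic, the vector
    survives the remaining contractions, and the augmentation kills it. *)
Lemma frame_contr_omega r s z : augmentation V (frame_contr r s (om * z)) = 0.
Proof.
elim: r z => [|i r IH] z /=.
  rewrite rmorphM rmorph_sum big1 ?mul0r // => i _.
  by rewrite rmorphM /= augmentation_dpow mul0r.
rewrite contrM contr_omega linearD linearD /= IH add0r frame_contr_isotropic.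
by rewrite rmorphM /= augmentation_dpow mul0r.
Qed.

Lemma contr_frame_monomial r s t i : i \notin r ->
  contr (frame t i) (frame_monomial r s) = 0.
Proof.
rewrite /frame_monomial; elim: r => [|j r IH]; first by rewrite big_nil contr1.
rewrite inE negb_or => /andP[ij ir]; rewrite big_cons contr_vectorM IH //.
by rewrite form_frame // eq_sym (negPf ij) scale0r mulr0 addr0.
Qed.

Lemma frame_contr_monomial r s t : uniq r ->
  frame_contr r t (frame_monomial r s) = (all (fun i => s i == t i) r)%:R.
Proof.
elim: r => [|i r IH]; first by rewrite /frame_monomial big_nil.
move=> /andP[ir ur]; rewrite /frame_monomial big_cons [LHS]/=.
rewrite contr_vectorM contr_frame_monomial // mulr0 add0r form_frame // eqxx.
rewrite linearZ /= IH //; case: (s i); case: (t i);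
  by rewrite /= ?scale1r ?scale0r.
Qed.

Notation I := (enum 'I_m).

(** The vectors of the spin module: square-free monomials of weight
    +-eps_1 +- ... +- eps_m. *)
Definition spin (s : 'I_m -> bool) : D := frame_monomial I s.
Definition spin_coef (s : 'I_m -> bool) (z : D) : K :=
  augmentation V (frame_contr I s z).

Fact spin_coef_linear s : scalar (spin_coef s).
Proof. by move=> a z w; rewrite /spin_coef !linearP. Qed.
HB.instance Definition _ s :=
  GRing.isLinear.Build K D K *%R (spin_coef s) (spin_coef_linear s).

Lemma spin_coef_coboundary s k z : z \in coboundaries B k -> spin_coef s z = 0.
Proof.
case/coboundariesP => [[_ ->]|[k' [_ [w _ ->]]]]; first exact: linear0.
exact: frame_contr_omega.
Qed.

Lemma spin_coef_spin (s t : {ffun 'I_m -> bool}) :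
  spin_coef s (spin t) = (s == t)%:R.
Proof.
rewrite /spin_coef /spin frame_contr_monomial ?enum_uniq //.
rewrite rmorph_nat; congr (_%:R); congr nat_of_bool.
apply/allP/eqP => [st|-> //]; apply/ffunP => i; apply/esym/eqP/st.
by rewrite mem_enum.
Qed.

(** In degrees 0 and 1 the double contraction vanishes, in accordance with
    D_j V = 0 for j < 0. *)
Lemma contr2_coboundary k u v z : z \in homog k ->
  om * contr v (contr u z) \in coboundaries B k.
Proof.
case: k => [|[|k]] zk.
- by rewrite (homog0_cst zk) linearZ /= contr1 scaler0 linear0 mulr0; exact: rpred0.
- have /homog0_cst -> := contr_homog u zk.
  by rewrite linearZ /= contr1 scaler0 mulr0; exact: rpred0.
- by apply: mem_coboundaries; do 2!apply: contr_homog.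
Qed.

(** On monomials, this multiplies by the total degree in x_i and y_i; modulo 2
    it is the projection onto the part where this degree is odd. *)
Definition euler (i : 'I_m) (z : D) : D :=
  dpow (x i) 1 * contr (y i) z + dpow (y i) 1 * contr (x i) z.

Lemma euler_coboundary i k z : z \in cocycles B k ->
  z - euler i z \in coboundaries B k.
Proof.
rewrite cocyclesE => /andP[zk /eqP oz].
have xy : f (x i) (y i) = 1 by rewrite sb_xy eqxx.
rewrite /euler (cocycle_homotopy xy oz) opprD addrA subrr add0r rpredN.
exact: contr2_coboundary.
Qed.

Definition set_sign (s : {ffun 'I_m -> bool}) (i : 'I_m) (b : bool) :=
  [ffun j => if j == i then b else s j].

Lemma frame_monomial_set_sign r s i b : i \notin r ->
  frame_monomial (i :: r) (set_sign s i b) =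
  dpow (if b then x i else y i) 1 * frame_monomial r s.
Proof.
move=> ir; rewrite /frame_monomial big_cons {1}/frame ffunE eqxx; congr (_ * _).
apply: eq_big_seq => j jr; rewrite /frame ffunE; case: eqP => // ji.
by rewrite ji (negPf ir) in jr.
Qed.

Lemma euler_monomial r (s : {ffun 'I_m -> bool}) i z : i \notin r ->
  euler i (frame_monomial r s * z) =
  frame_monomial (i :: r) (set_sign s i true) * contr (y i) z +
  frame_monomial (i :: r) (set_sign s i false) * contr (x i) z.
Proof.
move=> ir; have cf t : contr (frame t i) (frame_monomial r s) = 0.
  exact: contr_frame_monomial.
have := cf xpredT; have := cf pred0; rewrite /frame /= => cy cx.
by rewrite /euler !contrM cy cx !mul0r !addr0 !frame_monomial_set_sign // !mulrA.
Qed.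

(** Applying the Euler operators of the indices in r one at a time extracts one
    of x_i, y_i for each of them.  Terms already extracted are inert under the
    later contractions, whose indices are different. *)
Lemma cocycle_reduction r z : uniq r -> z \in cocycles B m ->
  exists l : seq ({ffun 'I_m -> bool} * D),
    (forall q, q \in l -> q.2 \in homog (m - size r)) /\
    let w := \sum_(q <- l) frame_monomial r q.1 * q.2 in
    w \in cocycles B m /\ z - w \in coboundaries B m.
Proof.
move=> ur zc; elim: r ur => [_|i r IH].
  exists [:: ([ffun=> true], z)]; split=> [q|].
    by rewrite inE subn0 => /eqP -> /=; move: zc; rewrite cocyclesE => /andP[].
  by rewrite /= big_seq1 /frame_monomial big_nil mul1r subrr rpred0.
move=> uir; have /andP[ir ur] := uir; have [l [lh]] := IH ur.
set w := \sum_(q <- l) _ => -[wc zw].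
have sr : (size r < m)%N.
  have /(uniq_leq_size uir) : {subset i :: r <= enum 'I_m}.
    by move=> j; rewrite mem_enum.
  by rewrite size_enum_ord.
exists (flatten [seq [:: (set_sign q.1 i true, contr (y i) q.2);
                         (set_sign q.1 i false, contr (x i) q.2)] | q <- l]).
split.
  move=> q /flattenP[_ /mapP[p /lh ph ->]].
  have mr : (m - size r = (m - (size r).+1).+1)%N by rewrite subnS prednK ?subn_gt0.
  rewrite mr in ph.
  by rewrite !inE => /orP[] /eqP -> /=; apply: contr_homog.
set w' := \sum_(q <- _) _ => /=.
have Dw' : w' = euler i w.
  rewrite /w' big_flatten big_map /w /euler !linear_sum !mulr_sumr -big_split /=.
  apply: eq_bigr => q _; rewrite big_cons big_seq1 /=.
  by rewrite -euler_monomial.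
have ww' : w - w' \in coboundaries B m by rewrite Dw'; exact: euler_coboundary.
split; last by rewrite -(subrK w z) -addrA rpredD.
rewrite -(subKr w w') rpredB //; exact: (coboundaries_sub char2).
Qed.

(** Once all indices have been treated, the cofactors of the frame monomials
    have degree 0, hence are scalars; their values are then read off by
    the coefficient functionals, which do not see coboundaries. *)
Lemma spin_span z : z \in cocycles B m ->
  z - \sum_(s : {ffun 'I_m -> bool}) spin_coef s z *: spin s \in coboundaries B m.
Proof.
move=> zc; have [l [lh [wc]]] := cocycle_reduction (enum_uniq 'I_m) zc.
set w := \sum_(q <- l) _ in wc * => zw.
have Dw : w = \sum_(q <- l) augmentation V q.2 *: spin q.1.
  rewrite /w big_seq [RHS]big_seq; apply: eq_bigr => q /lh.
  rewrite size_enum_ord subnn => /homog0_cst {1}->.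
  by rewrite -scalerAr mulr1.
suff <- : w = \sum_(s : {ffun 'I_m -> bool}) spin_coef s z *: spin s by [].
have -> : \sum_(s : {ffun 'I_m -> bool}) spin_coef s z *: spin s =
    \sum_(s : {ffun 'I_m -> bool}) spin_coef s w *: spin s.
  apply: eq_bigr => s _; rewrite -[z in LHS](subrK w) linearD /=.
  by rewrite (spin_coef_coboundary _ zw) add0r.
have Dspin (t : {ffun 'I_m -> bool}) :
    \sum_(s : {ffun 'I_m -> bool}) spin_coef s (spin t) *: spin s = spin t.
  rewrite (bigD1 t) //= spin_coef_spin eqxx scale1r big1 ?addr0 // => s st.
  by rewrite spin_coef_spin (negPf st) scale0r.
rewrite [in RHS]Dw; under eq_bigr do rewrite linear_sum scaler_suml.
rewrite exchange_big {1}Dw; apply: eq_bigr => q _ /=.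
rewrite -[in LHS]Dspin scaler_sumr; apply: eq_bigr => s _.
by rewrite [spin_coef s (_ *: _)]linearZ_LR /= scalerA.
Qed.

Lemma spin_homog s : spin s \in homog m.
Proof.
have H (r : seq 'I_m) : frame_monomial r s \in homog (size r).
  apply/asboolP; exists [:: (1, [seq (frame s i, 1%N) | i <- r])]; split.
    move=> t; rewrite inE => /eqP -> /=.
    by elim: r => //= i r ->.
  by rewrite big_seq1 scale1r /dp_monomial big_map.
by have := H I; rewrite size_enum_ord.
Qed.

(** Each term x_i y_i of omega meets a factor x_i or y_i of the monomial, and
    squares of vectors vanish in characteristic 2. *)
Lemma spin_cocycle s : spin s \in cocycles B m.
Proof.
have sq v : dpow v 1 * dpow v 1 = 0 :> D.
  by rewrite dpowM (pcharf0 char2) scale0r.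
rewrite cocyclesE spin_homog mulr_suml big1 ?eqxx // => i _.
rewrite /spin /frame_monomial big_enum (bigD1 i) //= mulrA /frame.
case: (s i); last by rewrite -(mulrA (dpow (x i) 1)) sq mulr0 mul0r.
by rewrite (mulrAC (dpow (x i) 1)) sq !mul0r.
Qed.

End Homology.

(** * The cohomology module and its rationality *)

Section SpinModule.
Variables (K : fieldType) (V : vectType K) (f : symplectic_form V) (m : nat).
Variables (B : symplectic_basis f m) (char2 : 2%N \in [pchar K]).

Notation M := (DV_cohomology B char2 m).
Notation signs := {ffun 'I_m -> bool}.
Notation frame := (frame B).
Notation spin := (spin B).
Notation spin_coef := (spin_coef B).

Definition coclass z (zc : z \in cocycles B m) : M :=
  subq_pi (coboundaries B m) (exist _ z zc).

Definition spin_class (s : signs) : M := coclass (spin_cocycle B char2 s).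

Lemma coclassP (v : M) : exists z (zc : z \in cocycles B m), v = coclass zc.
Proof. by have [[z zc] ->] := subq_piP v; exists z, zc. Qed.

Lemma coclass_eq0 z (zc : z \in cocycles B m) :
  coclass zc = 0 <-> z \in coboundaries B m.
Proof.
rewrite -(linear0 (subq_pi (coboundaries B m))) /coclass subq_pi_eq /=.
by rewrite subr0.
Qed.

Lemma coclass_act g z (zc : z \in cocycles B m) :
  exists gzc : dp_act g z \in cocycles B m, gact g (coclass zc) = coclass gzc.
Proof.
exists (@cocycles_stable _ _ _ _ B char2 m g z zc).
rewrite /= subq_act_pi; congr subq_pi; exact: val_inj.
Qed.

Lemma spin_class_sum (c : signs -> K)
    (sc : \sum_(s : signs) c s *: spin s \in cocycles B m) :
  \sum_(s : signs) c s *: spin_class s = coclass sc.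
Proof.
rewrite /spin_class /coclass; under eq_bigr do rewrite -linearZ.
rewrite -linear_sum; congr subq_pi; apply: val_inj.
by rewrite linear_sum; apply: eq_bigr => s _; rewrite linearZ.
Qed.

Lemma spin_sum_cocycle (c : signs -> K) : \sum_(s : signs) c s *: spin s \in cocycles B m.
Proof. by apply: rpred_sum => s _; apply: rpredZ; exact: spin_cocycle. Qed.

Lemma coclass_spin z (zc : z \in cocycles B m) :
  coclass zc = \sum_(s : signs) spin_coef s z *: spin_class s.
Proof.
rewrite (spin_class_sum (spin_sum_cocycle _)); apply/subq_pi_eq.
exact: spin_span.
Qed.

Lemma spin_class_span (v : M) : exists c : signs -> K,
  v = \sum_(s : signs) c s *: spin_class s.
Proof.
have [z [zc ->]] := coclassP v; exists (spin_coef^~ z); exact: coclass_spin.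
Qed.

Lemma spin_class_free (c : signs -> K) :
  \sum_(s : signs) c s *: spin_class s = 0 -> forall s, c s = 0.
Proof.
rewrite (spin_class_sum (spin_sum_cocycle c)) => /coclass_eq0 cb s.
have := spin_coef_coboundary char2 s cb; rewrite linear_sum (bigD1 s) //=.
rewrite [spin_coef s (_ *: _)]linearZ_LR /= spin_coef_spin // eqxx mulr1.
rewrite big1 ?addr0 // => t ts.
by rewrite [spin_coef s (_ *: _)]linearZ_LR /= spin_coef_spin // eq_sym (negPf ts) mulr0.
Qed.

Lemma spin_class_neq0 (s : signs) : spin_class s != 0.
Proof.
apply/eqP => s0; have := @spin_class_free (fun t => (t == s)%:R).
rewrite (bigD1 s) //= eqxx scale1r s0 big1 ?addr0 => [|t /negPf->].
  by move=> /(_ erefl)/(_ s)/eqP; rewrite eqxx oner_eq0.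
by rewrite scale0r.
Qed.

Lemma spin_class_act g s :
  gact g (spin_class s) = \sum_(t : signs) spin_coef t (dp_act g (spin s)) *: spin_class t.
Proof. by have [zc ->] := coclass_act g (spin_cocycle B char2 s); rewrite coclass_spin. Qed.

Lemma spin_act (g : Sp f) s :
  dp_act g (spin s) = \prod_i dpow (g (frame s i)) 1.
Proof.
rewrite /spin /frame_monomial rmorph_prod big_enum /=.
by apply: eq_bigr => i _; rewrite dp_act_dpow.
Qed.

Lemma regular_ext (p q : Sp f -> K) : p =1 q -> regular_fun p -> regular_fun q.
Proof. by move=> /funext ->. Qed.

Lemma regular_sum (J : Type) (r : seq J) (c : J -> Sp f -> K) :
  (forall j, regular_fun (c j)) -> regular_fun (fun g => \sum_(j <- r) c j g).
Proof.
move=> rc; elim: r => [|j r IH].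
  by apply: regular_ext (RegCst f 0) => g; rewrite big_nil.
by apply: regular_ext (RegAdd (rc j) IH) => g; rewrite big_cons.
Qed.

(** Finitely many fixed values with regular coefficients: a form that products
    in DV preserve and to which linear functionals apply termwise. *)
Definition regular_map (F : Sp f -> DV V) : Prop :=
  exists (J : finType) (w : J -> DV V) (c : J -> Sp f -> K),
    (forall j, regular_fun (c j)) /\ forall g, F g = \sum_j c j g *: w j.

Lemma regular_mapM F G : regular_map F -> regular_map G ->
  regular_map (fun g => F g * G g).
Proof.
move=> [J [w [c [rc DF]]]] [J' [w' [c' [rc' DG]]]].
exists (J * J')%type, (fun p => w p.1 * w' p.2), (fun p g => c p.1 g * c' p.2 g).
split=> [p|g]; first exact: RegMul.
rewrite DF DG mulr_suml -(pair_bigA _ (fun j k => (c j g * c' k g) *: (w j * w' k))) /=.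
apply: eq_bigr => j _; rewrite mulr_sumr; apply: eq_bigr => k _.
by rewrite -scalerAl -scalerAr scalerA.
Qed.

Lemma regular_map_vector v : regular_map (fun g : Sp f => dpow (g v) 1).
Proof.
exists ('I_m + 'I_m)%type,
  (fun p => match p with inl i => dpow (sb_x B i) 1 | inr i => dpow (sb_y B i) 1 end),
  (fun p g => match p with inl i => f (sb_y B i) (g v) | inr i => f (sb_x B i) (g v) end).
split=> [[i|i]|g].
- exact: (RegCoef f (f (sb_y B i)) v).
- exact: (RegCoef f (f (sb_x B i)) v).
rewrite big_sumType /= -big_split /= [in LHS](sb_expand B (g v)) dpow1_sum.
by apply: eq_bigr => i _; rewrite dpow1D !dpow1Z (sform_sym f char2 (sb_y B i)).
Qed.

(** A translate of a spin monomial is a product of vectors g e_i, and each of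
    these has matrix coefficients as coordinates. *)
Lemma regular_spin_coef s t : regular_fun (fun g : Sp f => spin_coef t (dp_act g (spin s))).
Proof.
have [J [w [c [rc Dc]]]] : regular_map (fun g : Sp f => dp_act g (spin s)).
  have H r : regular_map (fun g : Sp f => \prod_(i <- r) dpow (g (frame s i)) 1).
    elim: r => [|i r IH]; last first.
      have [J [w [c [rc Dc]]]] := regular_mapM (regular_map_vector (frame s i)) IH.
      by exists J, w, c; split=> // g; rewrite big_cons Dc.
    exists unit, (fun=> 1), (fun=> fun=> 1); split=> [_|g]; first exact: RegCst.
    by rewrite big_nil (big_pred1 tt) ?scale1r // => -[].
  have [J [w [c [rc Dc]]]] := H (index_enum 'I_m).
  by exists J, w, c; split=> // g; rewrite spin_act Dc.
apply: (regular_ext (p := fun g => \sum_j c j g * spin_coef t (w j))).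
  move=> g; rewrite Dc linear_sum /=; apply: eq_bigr => j _.
  by rewrite [spin_coef t (_ *: _)]linearZ_LR.
by apply: regular_sum => j; apply: RegMul => //; exact: RegCst.
Qed.

Lemma spin_rational : gmod_rational M.
Proof.
move=> v; have [c Dv] := spin_class_span v.
(* The definition of rationality asks for ordinals as indices. *)
pose e (i : 'I_#|signs|) : signs := enum_val i.
pose c' t (g : Sp f) := \sum_(s : signs) c s * spin_coef t (dp_act g (spin s)).
exists #|signs|, (fun i => spin_class (e i)), (fun i => c' (e i)); split=> [i|g].
  by apply: regular_sum => s; apply: RegMul; [exact: RegCst|exact: regular_spin_coef].
have <- : \sum_(t : signs) c' t g *: spin_class t =
    \sum_i c' (e i) g *: spin_class (e i).
  by rewrite (reindex e) //; exact/onW_bij/enum_val_bij.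
rewrite Dv linear_sum; under [RHS]eq_bigr do rewrite scaler_suml.
rewrite exchange_big; apply: eq_bigr => s _.
rewrite linearZ /= spin_class_act scaler_sumr.
by apply: eq_bigr => t _; rewrite scalerA.
Qed.

End SpinModule.

(** * Irreducibility of the cohomology module *)

Section SpinIrreducible.
Variables (K : fieldType) (V : vectType K) (f : symplectic_form V) (m : nat).
Variables (B : symplectic_basis f m) (char2 : 2%N \in [pchar K]).

Notation M := (DV_cohomology B char2 m).
Notation signs := {ffun 'I_m -> bool}.
Notation frame := (frame B).
Notation spin := (spin B).
Notation spin_coef := (spin_coef B).
Notation spin_class := (spin_class B char2).

Definition long_root (b : bool) (i : 'I_m) : Sp f :=
  shear B (fun=> b) (delta_mx i i).

Lemma long_root_frame b i (t : 'I_m -> bool) j :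
  long_root b i (frame t j) =
    frame t j + ((j == i) && (t j != b))%:R *: frame (fun=> b) i.
Proof.
rewrite /long_root shearE ?trmx_delta // /shear_map; congr (_ + _).
rewrite (bigD1 i) //= (bigD1 i) //= !big1 ?addr0.
- by rewrite mxE !eqxx mul1r form_frame.
- by move=> k ki; rewrite big1 // => l _; rewrite mxE (negPf ki) mul0r scale0r.
- by move=> l li; rewrite mxE (negPf li) andbF mul0r scale0r.
Qed.

Lemma long_root_spin b i (t : signs) :
  dp_act (long_root b i) (spin t) =
    spin t + (t i != b)%:R *: spin (set_sign t i b).
Proof.
have Dspin (u : signs) :
    spin u = dpow (frame u i) 1 * \prod_(j | j != i) dpow (frame u j) 1.
  by rewrite /spin /frame_monomial big_enum (bigD1 i).
rewrite spin_act (bigD1 i) //= long_root_frame eqxx dpow1D dpow1Z mulrDl.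
rewrite (Dspin t) Dspin -scalerAl /frame ffunE eqxx -/(frame t _).
congr (_ * _ + _ *: (_ * _)); apply: eq_bigr => j ji.
  by rewrite long_root_frame (negPf ji) scale0r addr0.
by rewrite long_root_frame (negPf ji) scale0r addr0 /frame ffunE (negPf ji).
Qed.

Lemma spin_class_coef (t : signs) :
  \sum_(u : signs) spin_coef u (spin t) *: spin_class u = spin_class t.
Proof. by rewrite -(coclass_spin char2 (spin_cocycle B char2 t)). Qed.

Lemma long_root_class b i (t : signs) :
  gact (long_root b i) (spin_class t) =
    spin_class t + (t i != b)%:R *: spin_class (set_sign t i b).
Proof.
rewrite spin_class_act long_root_spin.
rewrite -(spin_class_coef t) -(spin_class_coef (set_sign t i b)).
rewrite scaler_sumr -big_split /=; apply: eq_bigr => u _.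
by rewrite linearD /= scalerDl [spin_coef u (_ *: _)]linearZ_LR scalerA.
Qed.

(** For a long root element g, the operator N = g - 1 sends a basis class to 0
    or to the class with the i-th sign changed.  Composing the N of the two
    opposite roots gives the projection onto the classes with prescribed i-th
    sign; applying these projections for all i isolates one basis class, and
    the operators N carry it to all the others. *)
Lemma spin_irreducible : gmod_irreducible M.
Proof.
split.
  by exists (spin_class [ffun=> true]); exact: spin_class_neq0.
move=> S [S0 SP] Sg.
have SB u v : u \in S -> v \in S -> u - v \in S.
  by move=> Su Sv; rewrite addrC -scaleN1r; apply: SP.
have SZ a v : v \in S -> a *: v \in S.
  by move=> Sv; rewrite -[_ *: _]addr0; apply: SP.
have SN b i v : v \in S -> gact (long_root b i) v - v \in S.
  by move=> Sv; apply: SB => //; apply: Sg.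
pose N b i (v : M) := gact (long_root b i) v - v.
have NE b i t : N b i (spin_class t) = (t i != b)%:R *: spin_class (set_sign t i b).
  by rewrite /N long_root_class addrC addKr.
have NZ b i a v : N b i (a *: v) = a *: N b i v.
  by rewrite /N linearZ scalerBr.
have Nsum b i (F : signs -> M) : N b i (\sum_t F t) = \sum_t N b i (F t).
  by rewrite /N linear_sum -sumrB.
have set_id (t : signs) i : set_sign t i (t i) = t.
  by apply/ffunP => j; rewrite ffunE; case: eqP => // ->.
have NN b i t : N b i (N (~~ b) i (spin_class t)) = (t i == b)%:R *: spin_class t.
  rewrite NE NZ NE ffunE eqxx; have -> : (t i != ~~ b) = (t i == b).
    by case: (t i); case: b.
  case: eqP => [<-|_]; last by rewrite !scale0r.
  rewrite !scale1r; have -> : (~~ t i != t i) by case: (t i).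
  rewrite scale1r; congr spin_class; apply/ffunP => j; rewrite !ffunE.
  by case: eqP => // ->.
have [v0|/existsNP[v]] := pselect (forall v, v \in S -> v = 0); first by left.
move/not_implyP => [Sv v0]; right.
have [c Dv] := spin_class_span v.
have [s cs] : exists s, c s != 0.
  apply: contrapT => noc; apply: v0; rewrite Dv big1 // => s _.
  have -> : c s = 0 by apply: contrapT => /eqP cs; apply: noc; exists s.
  exact: scale0r.
have Sr r : \sum_(t : signs) (c t * (all (fun i => t i == s i) r)%:R) *: spin_class t \in S.
  elim: r => [|i r IH].
    by under eq_bigr do rewrite /= mulr1; rewrite -Dv.
  have := SN (s i) i _ (SN (~~ s i) i _ IH); rewrite -/(N _ _ _) -/(N _ _ _) !Nsum.
  congr (_ \in S); apply: eq_bigr => t _; rewrite !NZ NN scalerA /=.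
  by rewrite -mulrA -natrM mulnb andbC.
have Ss : spin_class s \in S.
  have := SZ (c s)^-1 _ (Sr (enum 'I_m)); rewrite (bigD1 s) //= big1 ?addr0.
    have -> : all (fun i => s i == s i) (enum 'I_m) by apply/allP.
    by rewrite mulr1 scalerA mulVf // scale1r.
  move=> t ts; have -> : all (fun i => t i == s i) (enum 'I_m) = false.
    apply: contraNF ts => /allP st; apply/eqP/ffunP => i; apply/eqP/st.
    by rewrite mem_enum.
  by rewrite mulr0 scale0r.
have Sset t i b : spin_class t \in S -> spin_class (set_sign t i b) \in S.
  have [tb|tb] := eqVneq (t i) b.
    by rewrite -tb set_id.
  by move=> /(SN b i); rewrite -/(N _ _ _) NE tb scale1r.
have St t : spin_class t \in S.
  have Hr (r : seq _) : spin_class [ffun i => if i \in r then t i else s i] \in S.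
    elim: r => [|i r /(Sset _ i (t i)) IH].
      have -> : [ffun i => if i \in [::] then t i else s i] = s.
        by apply/ffunP=> i; rewrite ffunE.
      exact: Ss.
    have -> : [ffun j => if j \in i :: r then t j else s j] =
        set_sign [ffun j => if j \in r then t j else s j] i (t i).
      by apply/ffunP => j; rewrite !ffunE inE; case: eqP => // ->.
    exact: IH.
  have -> : t = [ffun i => if i \in enum 'I_m then t i else s i].
    by apply/ffunP => i; rewrite ffunE mem_enum.
  exact: Hr.
move=> w; have [d ->] := spin_class_span w.
by elim/big_ind: _ => [|u1 u2 Su1 Su2|t _] //; [rewrite -[u1]scale1r; apply: SP|apply: SZ].
Qed.

End SpinIrreducible.

(** * Weights of the cohomology module *)

Section Weights.
Variables (K : closedFieldType) (V : vectType K) (f : symplectic_form V) (m : nat).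
Variables (B : symplectic_basis f m) (char2 : 2%N \in [pchar K]).

Lemma torus_exists (t : 'I_m -> K) : (forall i, t i != 0) ->
  exists g : Sp f, torus_elt B g t.
Proof.
move=> t0.
have [i j|i j|i j|g gE] := frame_sp B char2 (X := fun i => t i *: sb_x B i)
  (Y := fun i => (t i)^-1 *: sb_y B i).
- by rewrite linearZl_LR linearZr_LR /= sb_xx !mulr0.
- by rewrite linearZl_LR linearZr_LR /= sb_yy !mulr0.
- rewrite linearZl_LR linearZr_LR /= sb_xy.
  by case: eqP => [->|_]; rewrite ?mulr0 // mulr1 mulfV.
by exists g => i; have [-> ->] := gE i.
Qed.

(** The polynomial X^(k+2) - X would vanish identically if a^(k+1) = 1 for all
    nonzero a. *)
Lemma expz_inj (n p : int) : (forall a : K, a != 0 -> a ^ n = a ^ p) -> n = p.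
Proof.
move=> np; apply/eqP; rewrite -subr_eq0; apply/eqP.
have {np} : forall a : K, a != 0 -> a ^ (n - p) = 1.
  by move=> a a0; rewrite expfzDr // np // -expfzDr // subrr expr0z.
have pos k : (forall a : K, a != 0 -> a ^+ k = 1) -> k = 0%N.
  case: k => // k k1.
  have /(congr1 (fun q : {poly K} => lead_coef q)) : 'X^(k.+2) - 'X = 0 :> {poly K}.
    apply: poly_vanish => a; rewrite !hornerE.
    by have [->|/k1 ak] := eqVneq a 0; rewrite ?expr0n ?subrr // exprS ak mulr1 subrr.
  rewrite lead_coefDl ?size_polyXn ?size_opp ?size_polyX // lead_coefXn lead_coef0.
  by move/eqP; rewrite oner_eq0.
case: (n - p) => k k1; first by rewrite [k]pos.
suff : k.+1 = 0%N by [].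
by apply: pos => a a0; rewrite -[LHS]invrK -[X in X^-1]/(a ^ Negz k) k1 ?invr1.
Qed.

Lemma character_inj (mu la : 'rV[int]_m) :
  (forall t : 'I_m -> K, (forall i, t i != 0) ->
     character_eval mu t = character_eval la t) -> mu = la.
Proof.
move=> ml; apply/rowP => i; apply: expz_inj => a a0.
have := ml (fun j => if j == i then a else 1).
rewrite /character_eval !(bigD1 i (P := xpredT)) //= eqxx.
rewrite !big1 ?mulr1; first by apply=> j; case: (j == i); rewrite ?oner_eq0.
- by move=> j /negPf->; rewrite exp1rz.
- by move=> j /negPf->; rewrite exp1rz.
Qed.

Lemma character_evalD (mu la : 'rV[int]_m) t : (forall i, t i != 0 :> K) ->
  character_eval (mu + la) t = character_eval mu t * character_eval la t.
Proof.
move=> t0; rewrite /character_eval -big_split /=; apply: eq_bigr => i _.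
by rewrite mxE expfzDr.
Qed.

(** The weight of a spin monomial; all signs positive give omega_m. *)
Definition sign_weight (s : 'I_m -> bool) : 'rV[int]_m :=
  \row_i (if s i then 1 else -1).

Lemma fund_weightE : fund_weight m m = sign_weight xpredT.
Proof.
apply/rowP => j; rewrite mxE /fund_weight summxE /= (bigD1 j) ?ltn_ord //=.
rewrite big1 ?addr0 => [|i /andP[_ ij]]; rewrite mxE ?eqxx //=.
by rewrite eq_sym (negPf ij).
Qed.

Lemma weight_leD (mu la nu : 'rV[int]_m) :
  weight_le mu la -> weight_le nu mu -> weight_le nu la.
Proof.
move=> [n Dn] [p Dp]; exists (fun i => n i + p i)%N.
rewrite -(subrK mu la) -addrA Dn Dp -big_split /=; apply: eq_bigr => i _.
by rewrite mulrnDr.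
Qed.

Lemma weight_le_refl (mu : 'rV[int]_m) : weight_le mu mu.
Proof. by exists (fun=> 0%N); rewrite subrr big1. Qed.

(** 2 eps_i = 2 (eps_i - eps_(i+1)) + 2 eps_(i+1), down to the last simple root
    2 eps_m. *)
Lemma weight_le_eps2 (la : 'rV[int]_m) (i : 'I_m) : weight_le (la - eps i *+ 2) la.
Proof.
have [k] := ubnP (m - i); elim: k i la => // k IH i la.
rewrite ltnS => mik.
have simple j (mu : 'rV[int]_m) : weight_le (mu - simple_root j) mu.
  exists (fun l => (l == j : nat)).
  rewrite subKr (bigD1 j) //= eqxx mulr1n big1 ?addr0 // => l /negPf->.
  by rewrite mulr0n.
have [im|im] := eqVneq i.+1 m.
  by have := simple i la; rewrite /simple_root im eqxx.
have im' : (i.+1 < m)%N by rewrite ltn_neqAle im ltn_ord.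
pose j := Ordinal im'.
have Dr : simple_root i = eps i - eps j.
  rewrite /simple_root (negPf im); congr (_ - _).
  by rewrite (big_pred1 j) // => l; rewrite -val_eqE.
have -> : la - eps i *+ 2 = la - eps j *+ 2 - simple_root i - simple_root i.
  by rewrite Dr -!addrA !opprB -mulr2n mulrnBl addKr.
apply: weight_leD (simple _ _); apply: weight_leD (simple _ _).
by apply: IH; apply: leq_trans mik; rewrite ltn_sub2l.
Qed.

Lemma sign_weight_le (s : {ffun 'I_m -> bool}) :
  weight_le (sign_weight s) (fund_weight m m).
Proof.
rewrite fund_weightE.
have -> : sign_weight s = sign_weight xpredT - \sum_(i <- enum 'I_m | ~~ s i) eps i *+ 2.
  apply/rowP => j; rewrite !mxE summxE big_enum_cond /=.
  rewrite (eq_bigr (fun i => (j == i)%:R *+ 2)); last first.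
    by move=> i _; rewrite mulmxnE !mxE eqxx.
  have [sj|sj] := boolP (s j).
    rewrite big1 ?subr0 // => i si; case: eqP => [ji|]; last by rewrite mul0rn.
    by rewrite -ji sj in si.
  rewrite (bigD1 j) //= eqxx big1 ?addr0 // => i /andP[_ ij].
  by rewrite eq_sym (negPf ij) mul0rn.
elim: (enum _) => [|i r IH]; first by rewrite big_nil subr0; exact: weight_le_refl.
rewrite big_cons; case: (~~ _) => //; rewrite (addrC (eps i *+ 2)) opprD addrA.
exact: weight_leD IH (weight_le_eps2 _ _).
Qed.

End Weights.

Section SpinWeights.
Variables (K : closedFieldType) (V : vectType K) (f : symplectic_form V) (m : nat).
Variables (B : symplectic_basis f m) (char2 : 2%N \in [pchar K]).
Notation M := (DV_cohomology B char2 m).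
Notation signs := {ffun 'I_m -> bool}.
Notation spin_class := (spin_class B char2).

Lemma torus_spin g t (s : signs) : torus_elt B g t ->
  gact g (spin_class s) = character_eval (sign_weight s) t *: spin_class s.
Proof.
move=> gt; rewrite spin_class_act -[in RHS](spin_class_coef B char2 s).
have -> : dp_act g (spin B s) = character_eval (sign_weight s) t *: spin B s.
  rewrite spin_act /spin /frame_monomial big_enum -scaler_prod.
  apply: eq_bigr => i _; rewrite -dpow1Z mxE /frame.
  by have [_ gx gy] := gt i; case: (s i); rewrite ?gx ?gy.
rewrite scaler_sumr; apply: eq_bigr => u _.
by rewrite [spin_coef B u (_ *: _)]linearZ_LR scalerA.
Qed.

Lemma spin_weight (mu : 'rV[int]_m) : is_weight B M mu ->
  exists s : signs, mu = sign_weight s.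
Proof.
move=> [v v0 vmu]; have [c Dv] := spin_class_span v.
have [s cs] : exists s, c s != 0.
  apply: contrapT => noc; case/eqP: v0; rewrite Dv big1 // => s _.
  have -> : c s = 0 by apply: contrapT => /eqP cs; apply: noc; exists s.
  exact: scale0r.
exists s; apply: (@character_inj K) => t t0.
have [g gt] := torus_exists B char2 t0.
have := vmu g t gt; rewrite Dv linear_sum scaler_sumr => /eqP.
rewrite -subr_eq0 -sumrB; under eq_bigr => u _ do
  rewrite linearZ /= (torus_spin _ gt) !scalerA -scalerBl.
move/eqP/spin_class_free/(_ s)/eqP.
rewrite mulrC -mulrBl mulf_eq0 (negPf cs) orbF subr_eq0.
by move/eqP.
Qed.

Lemma spin_simple : is_simple_module B (fund_weight m m) M.
Proof.
split; [exact: spin_irreducible|exact: spin_rational|split].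
  exists (spin_class [ffun=> true]); first exact: spin_class_neq0.
  move=> g t gt; rewrite (torus_spin _ gt) fund_weightE.
  by congr (character_eval _ _ *: _); apply/rowP => i; rewrite !mxE ffunE.
by move=> mu /spin_weight[s ->]; exact: sign_weight_le.
Qed.

End SpinWeights.

(** * Weights and one-parameter groups of shears *)

Section Minuscule.
Variables (K : closedFieldType) (V : vectType K) (f : symplectic_form V) (m : nat).
Variables (B : symplectic_basis f m) (char2 : 2%N \in [pchar K]).
Notation frame := (frame B).
Notation x := (sb_x B).
Notation y := (sb_y B).

Section Weights.
Variable L : gmodule K (Sp f).

Lemma is_weight_tperm (mu : 'rV[int]_m) (i j : 'I_m) :
  is_weight B L mu -> is_weight B L (col_perm (tperm i j) mu).
Proof.
move=> [v v0 vmu]; set s := tperm i j.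
have inj k l : (s k == s l) = (k == l) by rewrite (inj_eq perm_inj).
have [k l|k l|k l|g gE] := frame_sp B char2 (X := fun k => x (s k)) (Y := fun k => y (s k)).
- exact: sb_xx.
- exact: sb_yy.
- by rewrite sb_xy inj.
exists (gact g v).
  apply/eqP => gv0; case/eqP: v0.
  by rewrite -[v]gact1 -(mulVg g) gactM gv0 linear0.
move=> h t ht; pose h' := (g^-1 * h * g)%g.
have h't : torus_elt B h' (fun k => t (s k)).
  move=> k; have [tk hx hy] := ht (s k); have [gx gy] := gE k.
  have gV w : (g^-1)%g (g w) = w by exact: (lker0_lfunK (Sp_lker g) w).
  split=> //; rewrite !comp_lfunE ?gx ?gy ?hx ?hy linearZ /=.
    by rewrite -gx gV.
  by rewrite -gy gV.
have -> : gact h (gact g v) = gact g (gact h' v).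
  by rewrite -!gactM /h' !mulgA mulgV mul1g.
rewrite (vmu _ _ h't) linearZ; congr (_ *: _).
rewrite /character_eval (reindex_inj (@perm_inj _ s)) /=; apply: eq_bigr => k _.
by rewrite tpermK mxE.
Qed.

(** No simple root has a negative first coordinate. *)
Lemma weight_le_first (mu la : 'rV[int]_m) (i : 'I_m) : i = 0%N :> nat ->
  weight_le mu la -> mu 0 i <= la 0 i.
Proof.
move=> i0 [n /rowP/(_ i)]; rewrite !mxE -subr_ge0 => ->.
rewrite summxE sumr_ge0 // => j _; rewrite mulmxnE mulrn_wge0 // /simple_root.
case: ifP => _; first by rewrite mulmxnE mulrn_wge0 // mxE.
rewrite !mxE summxE big1 ?subr0 // => k /eqP kj.
by rewrite mxE; have -> : (i == k) = false by rewrite -val_eqE /= kj i0.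
Qed.

Hypothesis hL : highest_weight B L (fund_weight m m).

(** For the first coordinate this is the bound by the highest weight; the
    others follow since transpositions in the Weyl group permute weights. *)
Lemma weight_le1 (mu : 'rV[int]_m) i : is_weight B L mu -> mu 0 i <= 1.
Proof.
move=> wmu; pose i0 := Ordinal (leq_ltn_trans (leq0n _) (ltn_ord i)).
have /hL.2/(@weight_le_first _ _ i0 erefl) := is_weight_tperm i0 i wmu.
by rewrite fund_weightE !mxE tpermL.
Qed.

End Weights.

Section Curves.
Variable L : gmodule K (Sp f).
Hypothesis rL : gmod_rational L.

Lemma regular_shear_poly (c : Sp f -> K) s Q : Q^T = Q -> regular_fun c ->
  exists p : {poly K}, forall t, c (shear B s (t *: Q)) = p.[t].
Proof.
move=> sQ; elim=> [a|phi v|p q _ [p' Dp] _ [q' Dq]|p q _ [p' Dp] _ [q' Dq]].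
- by exists a%:P => t; rewrite hornerC.
- exists ((phi v)%:P + (phi (shear_map B s Q v - v))%:P * 'X) => t.
  rewrite !hornerE shearE ?linearZ /= ?sQ // -{1}(subrK v (shear_map B s (t *: Q) v)).
  rewrite linearD addrC; congr (_ + _); rewrite mulrC.
  rewrite -[RHS](linearZ_LR phi); congr (phi _); rewrite /shear_map !(addrC v) !addrK.
  rewrite scaler_sumr; apply: eq_bigr => i _; rewrite scaler_sumr; apply: eq_bigr => j _.
  by rewrite mxE scalerA mulrA.
- by exists (p' + q') => t; rewrite hornerD Dp Dq.
- by exists (p' * q') => t; rewrite hornerM Dp Dq.
Qed.

(** By rationality, a vector moves along a polynomial curve under a
    one-parameter group of shears. *)
Lemma shear_curve s Q (v : L) : Q^T = Q -> exists (n : nat) (p : nat -> L),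
  forall t, gact (shear B s (t *: Q)) v = \sum_(k < n) t ^+ k *: p k.
Proof.
move=> sQ; have [N [w [c [rc Dc]]]] := rL v.
have /choice[P DP] : forall i, exists p : {poly K}, forall t,
    c i (shear B s (t *: Q)) = p.[t].
  by move=> i; apply: regular_shear_poly.
exists (\max_i size (P i))%N, (fun k => \sum_i (P i)`_k *: w i) => t.
rewrite Dc; under [RHS]eq_bigr do rewrite scaler_sumr.
rewrite exchange_big; apply: eq_bigr => i _ /=.
have sP : (size (P i) <= \max_i size (P i))%N.
  exact: (leq_bigmax_cond (F := fun i => size (P i))).
rewrite DP (horner_coef_wide _ sP) scaler_suml.
by apply: eq_bigr => k _; rewrite scalerA mulrC.
Qed.

Lemma curve_unique (n : nat) (p : nat -> L) :
  (forall t : K, t != 0 -> \sum_(k < n) t ^+ k *: p k = 0) ->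
  forall k, (k < n)%N -> p k = 0.
Proof.
move=> p0 k kn; have := @vpoly_coef0 K L [seq ('X^i, p i) | i <- iota 0 n].
move=> /(_ _ k); rewrite big_map (bigD1_seq k) ?iota_uniq ?mem_iota //= coefXn eqxx.
rewrite scale1r big1 ?addr0 => [|i ik]; last by rewrite coefXn eq_sym (negPf ik) scale0r.
apply=> t /p0 {2}<-; rewrite big_map -(big_mkord xpredT (fun k => t ^+ k *: p k)).
by rewrite /index_iota subn0; apply: eq_bigr => i _; rewrite hornerXn.
Qed.

End Curves.

Definition frame_char (s : 'I_m -> bool) (t : 'I_m -> K) i :=
  if s i then t i else (t i)^-1.

Lemma torus_frame g t s i : torus_elt B g t ->
  g (frame s i) = frame_char s t i *: frame s i.
Proof.
by move=> gt; have [_ gx gy] := gt i; rewrite /frame /frame_char; case: (s i).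
Qed.

Definition twist_mx (chi : 'I_m -> K) (Q : 'M[K]_m) : 'M[K]_m :=
  \matrix_(i, j) (chi i * chi j * Q i j).

Lemma tr_twist_mx chi Q : Q^T = Q -> (twist_mx chi Q)^T = twist_mx chi Q.
Proof.
by move=> sQ; apply/matrixP => i j; rewrite !mxE (mulrC (chi j)) -[in RHS]sQ mxE.
Qed.

Lemma torus_shear g t s (Q : 'M[K]_m) : torus_elt B g t -> Q^T = Q ->
  (g * shear B s Q = shear B s (twist_mx (frame_char s t) Q) * g)%g.
Proof.
move=> gt sQ; have sQ' := tr_twist_mx (frame_char s t) sQ.
apply: (frame_sp_eq (B := B) (s := s)) => i; rewrite !comp_lfunE.
  by rewrite shear_frame // !(torus_frame _ _ gt) linearZ /= shear_frame.
rewrite shear_coframe // !(torus_frame _ _ gt) linearZ /= shear_coframe //.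
rewrite linearD linear_sum /= (torus_frame _ _ gt) scalerDr scaler_sumr.
congr (_ + _); apply: eq_bigr => j _.
rewrite linearZ /= (torus_frame _ _ gt) !scalerA mxE; congr (_ *: _).
have [ti _ _] := gt i; rewrite /frame_char /=; case: (s i) => /=;
 rewrite !mulrA ?mulVf ?mulfV // mul1r mulrC //.
Qed.

(** The symmetric matrices whose shears are the root elements for the long
    roots (i = j) and the short roots (i <> j). *)
Definition root_mx (i j : 'I_m) : 'M[K]_m :=
  if i == j then delta_mx i i else delta_mx i j + delta_mx j i.

Lemma tr_root_mx i j : (root_mx i j)^T = root_mx i j.
Proof.
rewrite /root_mx; case: eqP => _; first by rewrite trmx_delta.
by rewrite linearD /= !trmx_delta addrC.
Qed.

Lemma symmetric_root_mx (Q : 'M[K]_m) : Q^T = Q ->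
  Q = \sum_(i < m) \sum_(j < m | (i <= j)%N) Q i j *: root_mx i j.
Proof.
move=> sQ; have sQE i j : Q i j = Q j i by rewrite -[in LHS]sQ mxE.
apply/matrixP => a b; wlog ab : a b / (a <= b)%N.
  move=> H; have [/H//|/ltnW/H ba] := leqP a b.
  rewrite sQE ba !summxE; apply: eq_bigr => i _; rewrite !summxE.
  by apply: eq_bigr => j _; rewrite !mxE -[in LHS](tr_root_mx i j) mxE.
rewrite summxE (bigD1 a) //= summxE (bigD1 b) //= !big1 ?addr0.
- rewrite mxE /root_mx; have [->|ab'] := eqVneq a b.
    by rewrite mxE !eqxx mulr1.
  by rewrite !mxE !eqxx (negPf ab') eq_sym (negPf ab') addr0 mulr1.
- move=> i ia; rewrite summxE big1 // => j ij; rewrite mxE /root_mx.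
  case: eqVneq => ij'; rewrite !mxE [a == i]eq_sym (negPf ia) /= ?mulr0 // add0r.
  case: eqP => [aj|]; last by rewrite mulr0.
  case: eqP => [bi|]; rewrite ?mulr0 //.
  by case/eqP: ij'; apply/val_inj/anti_leq; rewrite ij /= -bi -aj ab.
- move=> j /andP[aj jb]; rewrite mxE /root_mx.
  case: eqVneq => aj'; rewrite !mxE.
    by rewrite aj' [b == j]eq_sym (negPf jb) andbF mulr0.
  by rewrite [b == j]eq_sym (negPf jb) andbF (negPf aj') /= addr0 mulr0.
Qed.

End Minuscule.

(** * The stabilizer of a Lagrangian and highest weight vectors *)

Section HighestVector.
Variables (K : closedFieldType) (V : vectType K) (f : symplectic_form V) (m : nat).
Variables (B : symplectic_basis f m) (char2 : 2%N \in [pchar K]).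
Notation frame := (frame B).
Notation x := (sb_x B).
Notation y := (sb_y B).

Variable L : gmodule K (Sp f).
Hypothesis rL : gmod_rational L.
Hypothesis hL : highest_weight B L (fund_weight m m).
Variable v : L.
Hypothesis vla : forall g t, torus_elt B g t ->
  gact g v = character_eval (fund_weight m m) t *: v.

Lemma shear0_act s (w : L) : gact (shear B s 0) w = w.
Proof. by rewrite shear0 //; exact: gact1. Qed.

Lemma char2_oppK (a : K) : - a = a.
Proof. exact: (char2_opp char2 (M := K^o)). Qed.

Definition frame_weight (s : 'I_m -> bool) (i : 'I_m) : 'rV[int]_m :=
  if s i then eps i else - eps i.

Lemma frame_char_eval s (t : 'I_m -> K) i :
  frame_char s t i = character_eval (frame_weight s i) t.
Proof.
rewrite /character_eval /frame_weight /frame_char (bigD1 i) //= big1 ?mulr1 => [|j ji].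
  by case: (s i); rewrite !mxE !eqxx.
by case: (s i); rewrite !mxE eqxx (negPf ji).
Qed.

Lemma character_evalMn (mu : 'rV[int]_m) n (t : 'I_m -> K) :
  (forall i, t i != 0) -> character_eval (mu *+ n) t = character_eval mu t ^+ n.
Proof.
move=> t0; elim: n => [|n IH].
  by rewrite mulr0n /character_eval big1 // => i _; rewrite mxE.
by rewrite mulrS character_evalD // IH exprS.
Qed.

Lemma twist_root chi (i j : 'I_m) (t : K) :
  twist_mx chi (t *: root_mx K i j) = (t * (chi i * chi j)) *: root_mx K i j.
Proof.
apply/matrixP => a b; rewrite !mxE mulrCA -mulrA; congr (_ * _).
rewrite /root_mx; case: eqVneq => [->|ij]; rewrite !mxE.
  case: (eqVneq a j) => [->|_] /=; last by rewrite !mulr0.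
  by case: (eqVneq b j) => [->|_] /=; rewrite ?mulr0.
case: (eqVneq a i) => [->|_] /=.
  by rewrite (negPf ij) /= addr0; case: (eqVneq b j) => [->|_]; rewrite ?mulr0.
rewrite add0r; case: (eqVneq a j) => [->|_] /=; last by rewrite !mulr0.
by case: (eqVneq b i) => [->|_]; rewrite ?mulr0 // (mulrC (chi j)).
Qed.

(** Expand the curve t |-> x_alpha(t) v in powers of t.  Conjugation by the
    torus shows that the coefficient of t^k has weight omega_m + k alpha, and
    for k > 0 the i-th coordinate of this weight exceeds 1.  So the curve is
    constant. *)
Lemma root_fixes (s : 'I_m -> bool) i j c : s i ->
  gact (shear B s (c *: root_mx K i j)) v = v.
Proof.
move=> si; set Q := root_mx K i j; have sQ : Q^T = Q by exact: tr_root_mx.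
have sZ t : (t *: Q)^T = t *: Q by rewrite linearZ /= sQ.
have [n [p Dp]] := shear_curve B char2 rL s v sQ.
pose a := frame_weight s.
pose la : 'rV[int]_m := fund_weight m m.
have wp k : (k < n)%N -> forall g t, torus_elt B g t ->
    gact g (p k) = character_eval (la + (a i + a j) *+ k) t *: p k.
  move=> kn g t gt; apply/eqP; rewrite -subr_eq0; apply/eqP.
  have t0 l : t l != 0 by have [] := gt l.
  pose chi := character_eval (a i + a j) t.
  have Echi : frame_char s t i * frame_char s t j = chi.
    by rewrite !frame_char_eval -character_evalD.
  pose q k := gact g (p k) - character_eval (la + (a i + a j) *+ k) t *: p k.
  apply: (curve_unique (p := q) (n := n)) => // u _.
  have : gact (g * shear B s (u *: Q))%g v =
         gact (shear B s ((u * chi) *: Q) * g)%g v.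
    by rewrite (torus_shear _ _ gt) // twist_root Echi.
  rewrite !gactM !Dp (vla gt) linearZ /= Dp => /eqP.
  rewrite linear_sum scaler_sumr -subr_eq0 -sumrB => /eqP E.
  rewrite -[RHS]E; apply: eq_bigr => l _; rewrite /q scalerBr [gact g (_ *: _)]linearZ /=.
  congr (_ - _); rewrite !scalerA character_evalD // character_evalMn // -/chi.
  by rewrite exprMn mulrCA mulrA.
have p0 k : (0 < k < n)%N -> p k = 0.
  case/andP=> k0 kn; apply: contrapT => /eqP pk.
  have w : is_weight B L (la + (a i + a j) *+ k) by exists (p k) => //; exact: wp.
  have := weight_le1 char2 hL i w.
  rewrite mxE /la fund_weightE [X in X + _]mxE /=.
  rewrite gerDl mulmxnE leNgt pmulrn_lgt0 // mxE /a /frame_weight si.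
  have [<-|ij] := eqVneq i j; first by rewrite si mxE !eqxx.
  by case: (s j); rewrite !mxE !eqxx (negPf ij).
have -> : gact (shear B s (c *: Q)) v = gact (shear B s (0 *: Q)) v.
  rewrite !Dp; apply: eq_bigr => k _; case: (posnP k) => [->//|k0].
  by rewrite p0 ?scaler0 // k0 ltn_ord.
by rewrite scale0r shear0_act.
Qed.

Lemma shear_fixes s (Q : 'M[K]_m) : Q^T = Q ->
  (forall i j, Q i j != 0 -> s i || s j) -> gact (shear B s Q) v = v.
Proof.
move=> sQ Qs; pose good (R : 'M[K]_m) := R^T = R /\ gact (shear B s R) v = v.
suff : good Q by case.
have goodD R R' : good R -> good R' -> good (R + R').
  move=> [sR Rv] [sR' Rv']; split; first by rewrite linearD /= sR sR'.
  by rewrite shearD // gactM Rv' Rv.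
have good0 : good 0 by split; rewrite ?trmx0 // shear0_act.
rewrite (symmetric_root_mx sQ).
elim/big_ind: _ => // i _; elim/big_ind: _ => // j ij.
split; first by rewrite linearZ /= tr_root_mx.
have [->|/Qs] := eqVneq (Q i j) 0; first by rewrite scale0r shear0_act.
case/orP=> [si|sj]; first exact: root_fixes.
have -> : root_mx K i j = root_mx K j i; last exact: root_fixes.
by rewrite /root_mx eq_sym; case: eqP => [->//|_]; rewrite addrC.
Qed.

(** Row j of the two blocks contains the coordinates of g x_j. *)
Definition x_block (g : Sp f) : 'M[K]_m := \matrix_(j, i) f (g (x j)) (y i).
Definition y_block (g : Sp f) : 'M[K]_m := \matrix_(j, i) f (g (x j)) (x i).
Definition x_minor (g : Sp f) : K := \det (x_block g).

Let fC := sform_sym f char2.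

Lemma image_x (g : Sp f) j :
  g (x j) = \sum_i (x_block g j i *: x i + y_block g j i *: y i).
Proof.
rewrite [LHS](sb_expand B); apply: eq_bigr => i _.
by rewrite !mxE (fC (x i)).
Qed.

(** An element that fixes X pointwise is a shear along X, hence a product of
    root elements that fix v. *)
Lemma x_unipotent_fixes (u : Sp f) : (forall j, u (x j) = x j) -> gact u v = v.
Proof.
move=> ux; pose Q : 'M[K]_m := \matrix_(j, k) f (u (y j)) (y k).
have uy j : u (y j) = y j + \sum_k Q j k *: x k.
  rewrite [LHS](sb_expand B) big_split /= addrC; congr (_ + _).
    rewrite (bigD1 j) //= -[x j]ux Sp_form sb_xy eqxx scale1r big1 ?addr0 // => i ij.
    by rewrite -[x i]ux Sp_form sb_xy (negPf ij) scale0r.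
  by apply: eq_bigr => k _; rewrite mxE.
have sQ : Q^T = Q.
  apply/matrixP => j k; rewrite mxE; apply/eqP; rewrite -subr_eq0.
  have : f (u (y j)) (u (y k)) = 0 by rewrite Sp_form sb_yy.
  rewrite (uy k) linearDr linear_sumr (bigD1 j) //= big1 => [|i ij].
    rewrite linearZr_LR /= -[x j]ux Sp_form (fC (y j)) sb_xy eqxx mulr1 addr0.
    by rewrite !mxE char2_oppK => e; rewrite addrC e.
  by rewrite linearZr_LR /= -[x i]ux Sp_form (fC (y j)) sb_xy (negPf ij) mulr0.
have -> : u = shear B xpredT Q.
  apply: (Sp_frame_eq (B := B)) => j.
    by rewrite ux -[x j in RHS]/(frame xpredT j) shear_frame.
  by rewrite uy -[y j in RHS]/(frame (negb \o xpredT) j) shear_coframe.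
exact: shear_fixes.
Qed.

Definition stabilizes_by (p : Sp f) (A : 'M[K]_m) :=
  forall j, p (x j) = \sum_i A j i *: x i.

(** Only the generators of GL_m have to be considered: torus elements act on v by
    their determinant because omega_m = eps_1 + ... + eps_m, and the elementary
    column operations are shears along the coordinate Lagrangian obtained from
    X on replacing x_k by y_k. *)
Lemma stabilizer_realized (A : 'M[K]_m) : A \in unitmx ->
  exists2 p : Sp f, stabilizes_by p A & gact p v = \det A *: v.
Proof.
move: A; apply: unitmx_elementary_ind => [A A'|d d0|k b bk].
- move=> [p pA pv] [p' pA' pv']; exists (p' * p)%g; last first.
    by rewrite gactM pv linearZ /= pv' scalerA det_mulmx.
  move=> j; rewrite comp_lfunE pA linear_sum /=.
  under eq_bigr => i _ do rewrite linearZ /= pA' scaler_sumr.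
  rewrite exchange_big; apply: eq_bigr => k _; rewrite mxE scaler_suml.
  by apply: eq_bigr => i _; rewrite scalerA.
- have [g gt] := torus_exists B char2 d0; exists g.
    move=> j; have [_ -> _] := gt j; rewrite (bigD1 j) //= mxE eqxx mulr1n.
    by rewrite big1 ?addr0 // => i ij; rewrite mxE eq_sym (negPf ij) mulr0n scale0r.
  rewrite (vla gt) det_diag fund_weightE; congr (_ *: _).
  by apply: eq_bigr => i _; rewrite mxE expr1z.
(* Here x_k lies in the dual frame, and the shear moves it by the other x_j. *)
- pose s j := j != k; pose D : 'M[K]_m := delta_mx k 0 *m b.
  have DE i j : D i j = (i == k)%:R * b 0 j by rewrite mxE big_ord1 mxE andbT.
  pose Q := D + D^T; have sQ : Q^T = Q by rewrite linearD /= trmxK addrC.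
  have QE i j : Q i j = (i == k)%:R * b 0 j + (j == k)%:R * b 0 i.
    by rewrite mxE [D^T _ _]mxE !DE.
  exists (shear B s Q).
    move=> j; under eq_bigr => i _ do rewrite mxE DE scalerDl.
    rewrite big_split /= (bigD1 j) //= mxE eqxx mulr1n scale1r big1 ?addr0; last first.
      by move=> i ij; rewrite mxE eq_sym (negPf ij) scale0r.
    have [->|jk] := eqVneq j k; last first.
      rewrite big1 ?addr0 => [|i _]; last by rewrite mul0r scale0r.
      have -> : x j = frame s j by rewrite /frame /s jk.
      by rewrite shear_frame.
    have {1}-> : x k = frame (negb \o s) k by rewrite /frame /s /= eqxx.
    rewrite shear_coframe // {1}/frame /s /= eqxx /=; congr (_ + _).
    apply: eq_bigr => i _; rewrite QE eqxx bk mulr0 addr0 /frame.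
    by have [->|_] := eqVneq i k; rewrite // bk mulr0 !scale0r.
  have -> : \det (1%:M + D) = 1.
    (* In characteristic 2 a scalar with square 1 is 1. *)
    have DD : (1%:M + D) *m (1%:M + D) = 1%:M.
      rewrite mulmxDl mul1mx mulmxDr mulmx1 -mulmxA (mulmxA b) -colE.
      have -> : col k b = 0 by apply/matrixP => i j; rewrite !ord1 !mxE.
      by rewrite mul0mx mulmx0 addr0 -addrA (char2_double char2) addr0.
    have := congr1 determinant DD; rewrite det_mulmx det1 -expr2 => /eqP.
    by rewrite sqrf_eq1 char2_oppK orbb => /eqP.
  rewrite scale1r shear_fixes // => i j; rewrite QE /s.
  have [->|//] := eqVneq i k; have [->|//] := eqVneq j k.
  by rewrite bk mulr0 addr0 eqxx.
Qed.

End HighestVector.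

(** * Linear relations between translates of a highest weight vector *)

Section GroupAlgebra.
Variables (K : fieldType) (G : groupType).
Implicit Types (M : gmodule K G) (r : seq (K * G)).

(** A list of pairs (c, g) stands for an element of the group algebra. *)
Definition group_act M r (w : M) : M := \sum_(q <- r) q.1 *: gact q.2 w.

Definition translate (h : G) r := [seq (q.1, (h * q.2)%g) | q <- r].

Definition scale_sum (a : K) r := [seq (a * q.1, q.2) | q <- r].

Lemma group_act_cat M r r' (w : M) :
  group_act (r ++ r') w = group_act r w + group_act r' w.
Proof. exact: big_cat. Qed.

Lemma group_act_scale M a r (w : M) : group_act (scale_sum a r) w = a *: group_act r w.
Proof.
rewrite /group_act big_map scaler_sumr.
by apply: eq_bigr => q _; rewrite scalerA.
Qed.

Lemma group_act_translate M h r (w : M) :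
  group_act (translate h r) w = gact h (group_act r w).
Proof.
rewrite /group_act big_map linear_sum; apply: eq_bigr => q _.
by rewrite linearZ gactM.
Qed.

Lemma irreducible_cyclic M (v : M) : gmod_irreducible M -> v != 0 ->
  forall w, exists r, group_act r v = w.
Proof.
move=> [_ irr] v0; pose S : {pred M} := fun w => `[< exists r, group_act r v = w >].
have S_sub : submod_closed S.
  split=> [|a _ _ /asboolP[r <-] /asboolP[r' <-]]; apply/asboolP.
    by exists [::]; rewrite /group_act big_nil.
  by exists (scale_sum a r ++ r'); rewrite group_act_cat group_act_scale.
have S_stable : gstable S.
  move=> h _ /asboolP[r <-]; apply/asboolP; exists (translate h r).
  exact: group_act_translate.
have [Sv|Sv] := irr S S_sub S_stable; last by move=> w; exact/asboolP/Sv.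
case/eqP: v0; apply: Sv; apply/asboolP; exists [:: (1, 1%g)].
by rewrite /group_act big_seq1 scale1r gact1.
Qed.

(** The isomorphism sends the sum of the c_i g_i v to the sum of the
    c_i g_i v'. *)
Lemma cyclic_isomorphic M M' (v : M) (v' : M') :
  (forall w, exists r, group_act r v = w) ->
  (forall w', exists r, group_act r v' = w') ->
  (forall r, group_act r v = 0 <-> group_act r v' = 0) ->
  gmod_isomorphic M M'.
Proof.
move=> /choice[R DR] /choice[R' DR'] ann.
have same r1 r2 : group_act r1 v = group_act r2 v <-> group_act r1 v' = group_act r2 v'.
  have E (N : gmodule K G) (u : N) : group_act r1 u = group_act r2 u <->
      group_act (r1 ++ scale_sum (-1) r2) u = 0.
    rewrite group_act_cat group_act_scale scaleN1r; split=> [->|/eqP].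
      exact: subrr.
    by rewrite subr_eq0 => /eqP.
  by split=> /E/ann/E.
pose phi w := group_act (R w) v'.
have phiE r : phi (group_act r v) = group_act r v' by apply/same; rewrite DR.
have phi_lin : linear phi.
  move=> a u w; rewrite -{1}(DR u) -{1}(DR w) -group_act_scale -group_act_cat phiE.
  by rewrite group_act_cat group_act_scale.
pose phiM := GRing.isLinear.Build _ _ _ _ phi phi_lin.
pose phiL : {linear M -> M'} := HB.pack phi phiM.
exists phiL; split=> [|g w].
  exists (fun w' => group_act (R' w') v) => [w|w'] /=.
    by rewrite -[RHS]DR; apply/same; rewrite DR'.
  by rewrite phiE DR'.
rewrite -[w in LHS]DR -group_act_translate [LHS]phiE group_act_translate.
by [].
Qed.

End GroupAlgebra.

Section Cell.
Variables (K : closedFieldType) (V : vectType K) (f : symplectic_form V) (m : nat).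
Variables (B : symplectic_basis f m) (char2 : 2%N \in [pchar K]).
Notation frame := (frame B).
Notation x := (sb_x B).
Notation y := (sb_y B).
Notation x_block := (x_block B).
Notation y_block := (y_block B).
Notation x_minor := (x_minor B).

Lemma Sp_invK (g : Sp f) (w : V) : (g^-1)%g (g w) = w.
Proof. exact: (lker0_lfunK (Sp_lker g) w). Qed.

Lemma blocks_isotropic (g : Sp f) :
  x_block g *m (y_block g)^T = y_block g *m (x_block g)^T.
Proof.
apply/matrixP => j k; have : f (g (x j)) (g (x k)) = 0 by rewrite Sp_form sb_xx.
rewrite (image_x B char2 g k) linear_sumr => E; apply/eqP.
rewrite -subr_eq0 (char2_oppK char2) -[X in _ == X]E !mxE -big_split /=.
apply/eqP/eq_bigr => i _; rewrite linearDr !linearZr_LR /= !mxE addrC.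
by rewrite [in X in X + _]mulrC [in X in _ + X]mulrC.
Qed.

Lemma blocks_inj (g : Sp f) (u : 'rV_m) :
  u *m x_block g = 0 -> u *m y_block g = 0 -> u = 0.
Proof.
move=> ux uy; pose w := \sum_j u 0 j *: x j.
have gw : g w = 0.
  rewrite linear_sum; under eq_bigr => j _ do
    rewrite linearZ /= (image_x B char2) scaler_sumr.
  rewrite exchange_big big1 // => i _ /=.
  under eq_bigr => j _ do rewrite scalerDr !scalerA.
  rewrite big_split -!scaler_suml /=.
  have /rowP/(_ i) := ux; rewrite !mxE => ->.
  by have /rowP/(_ i) := uy; rewrite !mxE => ->; rewrite !scale0r addr0.
have w0 : w = 0 by rewrite -(Sp_invK g w) gw linear0.
apply/rowP => j; rewrite mxE; have : f w (y j) = 0 by rewrite w0 linear0l.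
rewrite linear_sumlz (bigD1 j) //= linearZl_LR /= sb_xy eqxx mulr1 big1 ?addr0 //.
by move=> i ij; rewrite linearZl_LR /= sb_xy (negPf ij) mulr0.
Qed.

Lemma x_block_shear (g : Sp f) Q : Q^T = Q ->
  x_block (shear B xpredT Q * g)%g = x_block g + y_block g *m Q.
Proof.
move=> sQ; apply/matrixP => j i; rewrite !mxE comp_lfunE shearE // /shear_map.
rewrite linearDl; congr (_ + _); rewrite linear_sumlz; apply: eq_bigr => k _.
rewrite linear_sumlz (bigD1 i) //= big1 ?addr0 => [|l li].
  by rewrite linearZl_LR /= [f (frame _ _) _]sb_xy eqxx mulr1 mxE mulrC.
by rewrite linearZl_LR /= [f (frame _ _) _]sb_xy (negPf li) mulr0.
Qed.

Lemma x_minor_poly (Q R : 'M[K]_m) : Q^T = Q -> R^T = R -> forall g : Sp f,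
  exists p : {poly K}, forall t,
    x_minor (shear B xpredT (Q + t *: R) * g)%g = p.[t].
Proof.
move=> sQ sR g.
exists (\det (map_mx polyC (x_block g + y_block g *m Q) +
              'X *: map_mx polyC (y_block g *m R))) => t.
rewrite -[RHS]/(horner_eval t _) -det_map_mx; congr determinant.
rewrite x_block_shear; last by rewrite linearD linearZ /= sQ sR.
apply/matrixP => i j; rewrite mulmxDr -scalemxAr addrA !mxE.
by rewrite -[RHS]/((_%:P + 'X * _%:P).[t]) !hornerE.
Qed.

(** A shear that works for one g and a shear that works for the others lie on a
    common line, on which each minor is a nonzero polynomial. *)
Lemma x_minor_generic (r : seq (Sp f)) : exists2 Q : 'M[K]_m, Q^T = Q &
  forall g, g \in r -> x_minor (shear B xpredT Q * g)%g != 0.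
Proof.
elim: r => [|g r [Q sQ Qr]]; first by exists 0; rewrite ?trmx0.
have [R sR Rg] := symmetric_transversal (blocks_isotropic g) (@blocks_inj g).
have sRQ : (R - Q)^T = R - Q by rewrite linearB /= sQ sR.
have /choice[P DP] := x_minor_poly sQ sRQ.
(* At t = 1 the shear is the one for g, at t = 0 the one for r. *)
have P0 : \prod_(h <- g :: r) P h != 0.
  rewrite prodf_seq_neq0; apply/allP => h; rewrite inE /= => /predU1P[->|hr].
    apply/eqP => Pg; case/eqP: Rg; rewrite -x_block_shear // -/(x_minor _).
    by have := DP g 1; rewrite scale1r addrC subrK Pg horner0.
  apply/eqP => Ph; have := Qr h hr; have := DP h 0.
  by rewrite scale0r addr0 Ph horner0 => ->; rewrite eqxx.
have [t] := poly_nonroot P0; rewrite horner_prod prodf_seq_neq0 => /allP Pt.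
exists (Q + t *: (R - Q)); first by rewrite linearD linearZ /= sRQ sQ.
by move=> h hr; rewrite DP; exact: Pt.
Qed.

Section Vector.
Variable L : gmodule K (Sp f).
Hypothesis rL : gmod_rational L.
Hypothesis hL : highest_weight B L (fund_weight m m).
Variable v : L.
Hypothesis v0 : v != 0.
Hypothesis vla : forall g t, torus_elt B g t ->
  gact g v = character_eval (fund_weight m m) t *: v.

(** Bruhat decomposition relative to the stabilizer of X: on the big cell,
    g = u p with u a shear along the y_i and p in the stabilizer.  The block
    of p is that of g, because u does not change x-coordinates. *)
Lemma cell_factorization (g : Sp f) : x_minor g != 0 ->
  exists2 Q : 'M[K]_m, Q^T = Q &
    gact g v = x_minor g *: gact (shear B xpred0 Q) v.
Proof.
rewrite -unitfE -unitmxE; set A := x_block g; set C := y_block g => uA.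
pose Q := invmx A *m C; have AQ : A *m Q = C by rewrite mulKVmx.
have sQ : Q^T = Q.
  have AC : A *m C^T = C *m A^T := blocks_isotropic g.
  rewrite -[LHS](mulKmx uA) /Q trmx_mul (mulmxA A) AC.
  by rewrite -(mulmxA C) -trmx_mul mulVmx // trmx1 mulmx1.
exists Q => //.
have [p pA pv] := stabilizer_realized char2 rL hL vla uA.
pose u := (p^-1 * ((shear B xpred0 Q)^-1 * g))%g.
have Dg : g = (shear B xpred0 Q * (p * u))%g by rewrite /u !mulVKg.
suff ux j : u (x j) = x j.
  clearbody u; rewrite -/A {1}Dg !gactM (x_unipotent_fixes char2 rL hL vla ux) pv.
  exact: linearZ.
have Dgx : g (x j) = shear B xpred0 Q (p (x j)).
  rewrite pA linear_sum (image_x B char2) big_split.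
  under [RHS]eq_bigr => i _.
    rewrite linearZ /= -[x i]/(frame (negb \o xpred0) i) shear_coframe //.
    rewrite scalerDr scaler_sumr; over.
  rewrite big_split /=; congr (_ + _); rewrite exchange_big; apply: eq_bigr => k _ /=.
  rewrite -/C -AQ mxE scaler_suml; apply: eq_bigr => i _.
  by rewrite scalerA.
by rewrite /u !comp_lfunE Dgx !Sp_invK.
Qed.

(** Acting by the torus element x_i |-> a^(-1) x_i rescales the shear factors by
    a^2, so the relation persists along the curves
    t |-> shear (t Q_i) v for all t <> 0; at t = 0 all of them reach v. *)
Lemma cell_relation (r : seq (K * Sp f)) :
  (forall q, q \in r -> x_minor q.2 != 0) -> group_act r v = 0 ->
  \sum_(q <- r) q.1 * x_minor q.2 = 0.
Proof.
move=> r0 rv.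
have /choice[Q HQ] : forall g : Sp f, exists Q : 'M[K]_m, x_minor g != 0 ->
    Q^T = Q /\ gact g v = x_minor g *: gact (shear B xpred0 Q) v.
  move=> g; have [g0|/cell_factorization[Q sQ gv]] := eqVneq (x_minor g) 0.
    by exists 0 => /negP[]; apply/eqP.
  by exists Q.
have /choice[P HP] : forall g : Sp f, exists P : seq ({poly K} * L),
    x_minor g != 0 -> forall t,
      gact (shear B xpred0 (t *: Q g)) v = \sum_(q <- P) q.1.[t] *: q.2.
  move=> g; have [g0|g0] := eqVneq (x_minor g) 0; first by exists [::].
  have [n [p Dp]] := shear_curve B char2 rL xpred0 v (HQ g g0).1.
  exists [seq ('X^k, p k) | k <- iota 0 n] => _ t; rewrite Dp big_map.
  rewrite -(big_mkord xpredT (fun k => t ^+ k *: p k)) /index_iota subn0.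
  by apply: eq_bigr => k _; rewrite hornerXn.
pose l := flatten [seq [seq ((q.1 * x_minor q.2) *: e.1, e.2) | e <- P q.2] | q <- r].
have El t : \sum_(e <- l) e.1.[t] *: e.2 =
    \sum_(q <- r) (q.1 * x_minor q.2) *: gact (shear B xpred0 (t *: Q q.2)) v.
  rewrite big_flatten big_map big_seq [RHS]big_seq; apply: eq_bigr => q /r0 q0.
  rewrite HP // big_map scaler_sumr; apply: eq_bigr => e _ /=.
  by rewrite hornerZ scalerA.
have : \sum_(e <- l) e.1.[0] *: e.2 = 0.
  apply: vpoly_at0 => t t0; rewrite El.
  (* The torus scales Q by squares. *)
  have [a] : exists a, root ('X^2 - t%:P) a.
    by apply/closed_rootP; rewrite size_XnsubC.
  rewrite rootE !hornerE subr_eq0 => /eqP a2.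
  have a0 : a != 0 by apply: contraNneq t0 => a0; rewrite -a2 a0 expr0n.
  have [g gt] := torus_exists B char2 (t := fun=> a^-1) (fun i => invr_neq0 a0).
  pose la := character_eval (fund_weight m m) (fun=> a^-1).
  have la0 : la != 0.
    by rewrite /la /character_eval; apply/prodf_neq0 => i _; rewrite expfz_neq0 ?invr_eq0.
  apply: (scalerI la0); rewrite scaler0 -[RHS](linear0 (gact g)) -[in RHS]rv.
  rewrite scaler_sumr.
  rewrite /group_act [RHS]linear_sum big_seq [RHS]big_seq; apply: eq_bigr => q /r0 q0.
  have [sQ gv] := HQ _ q0; rewrite gv ![gact g (_ *: _)]linearZ /= -gactM.
  rewrite (torus_shear char2 _ gt) // gactM (vla gt) [gact _ (_ *: _)]linearZ /= -/la.
  have -> : twist_mx (frame_char xpred0 (fun=> a^-1)) (Q q.2) = t *: Q q.2.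
    by apply/matrixP => i j; rewrite !mxE /frame_char /= invrK -expr2 a2.
  by rewrite !scalerA mulrC.
rewrite El; under eq_bigr => q _ do rewrite scale0r (shear0_act B char2).
rewrite -scaler_suml => /eqP; rewrite scaler_eq0 (negPf v0) orbF.
by move/eqP.
Qed.

(** Along the line of shears t Q, the sum of the c_i d(shear(t Q) g_i) is a
    polynomial in t that vanishes whenever all the minors are nonzero; its
    value at t = 0 is the sum in question. *)
Lemma relation_x_minor (r : seq (K * Sp f)) : group_act r v = 0 ->
  \sum_(q <- r) q.1 * x_minor q.2 = 0.
Proof.
move=> rv; have [Q sQ Qr] := x_minor_generic (unzip2 r).
have s0 : (0 : 'M[K]_m)^T = 0 by rewrite trmx0.
have /choice[P DP] := x_minor_poly s0 sQ.
pose p := \sum_(q <- r) q.1 *: P q.2.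
have Dp t : p.[t] =
    \sum_(q <- translate (shear B xpredT (t *: Q)) r) q.1 * x_minor q.2.
  rewrite /p horner_sum big_map; apply: eq_bigr => q _ /=.
  by rewrite hornerZ -DP add0r.
have P0 : \prod_(g <- unzip2 r) P g != 0.
  rewrite prodf_seq_neq0; apply/allP => g gr /=; apply/eqP => Pg.
  by have := Qr g gr; have := DP g 1; rewrite scale1r add0r Pg horner0 => ->; rewrite eqxx.
have p0 : p = 0.
  apply: (poly_vanish_generic P0) => t; rewrite horner_prod prodf_seq_neq0.
  move=> /allP Pt; rewrite Dp; apply: cell_relation.
    move=> _ /mapP[q qr ->] /=; have := DP q.2 t; rewrite add0r => ->.
    by apply: Pt; apply: map_f.
  by rewrite group_act_translate rv linear0.
rewrite -[RHS](horner0 0) -[in RHS]p0 Dp big_map; apply: eq_bigr => q _ /=.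
by rewrite scale0r shear0 // mul1g.
Qed.

End Vector.

End Cell.

(** * Uniqueness of the simple module *)

Section Uniqueness.
Variables (K : closedFieldType) (V : vectType K) (f : symplectic_form V) (m : nat).
Variables (B : symplectic_basis f m) (char2 : 2%N \in [pchar K]).
Notation x_minor := (x_minor B).
Notation la := (fund_weight m m).

Lemma x_minor1 : x_minor 1%g = 1.
Proof.
rewrite /x_minor (_ : x_block B 1%g = 1%:M) ?det1 //.
by apply/matrixP => i j; rewrite !mxE id_lfunE sb_xy.
Qed.

Definition minor_sum (h : Sp f) (r : seq (K * Sp f)) : K :=
  \sum_(q <- r) q.1 * x_minor (h * q.2)%g.

(** For the converse, the vectors that come from sums with all translated minor
    sums equal to 0 form a submodule.  It does not contain v, since
    d(1) = 1, so it is 0. *)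
Lemma annihilator_minor (L : gmodule K (Sp f)) (v : L) :
  is_simple_module B la L -> v != 0 ->
  (forall g t, torus_elt B g t -> gact g v = character_eval la t *: v) ->
  forall r, group_act r v = 0 <-> (forall h, minor_sum h r = 0).
Proof.
move=> [irr rL hL] v0 vla r.
have minorP r' : group_act r' v = 0 -> forall h, minor_sum h r' = 0.
  move=> r0 h; have := @relation_x_minor _ _ _ _ B char2 _ rL hL v v0 vla (translate h r').
  by rewrite group_act_translate r0 linear0 /minor_sum big_map; apply.
split; first exact: minorP.
pose S : {pred L} := fun w =>
  `[< exists r', group_act r' v = w /\ forall h, minor_sum h r' = 0 >].
have S_sub : submod_closed S.
  split=> [|a _ _ /asboolP[r1 [<- r1h]] /asboolP[r2 [<- r2h]]]; apply/asboolP.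
    by exists [::]; rewrite /group_act big_nil; split=> // h; rewrite /minor_sum big_nil.
  exists (scale_sum a r1 ++ r2); rewrite group_act_cat group_act_scale; split=> // h.
  rewrite /minor_sum big_cat big_map /= -/(minor_sum h r2) r2h addr0.
  under eq_bigr do rewrite -mulrA.
  by rewrite -mulr_sumr -/(minor_sum h r1) r1h mulr0.
have S_stable : gstable S.
  move=> g _ /asboolP[r1 [<- r1h]]; apply/asboolP; exists (translate g r1).
  split=> [|h]; first exact: group_act_translate.
  rewrite /minor_sum big_map -[RHS](r1h (h * g)%g); apply: eq_bigr => q _.
  by rewrite mulgA.
move=> rh; have Sr : group_act r v \in S by apply/asboolP; exists r.
case: (irr.2 S S_sub S_stable) => [/(_ _ Sr)//|/(_ v)/asboolP[r' [r'v r'h]]].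
have /minorP/(_ 1%g) : group_act ((-1, 1%g) :: r') v = 0.
  rewrite /group_act big_cons -/(group_act r' v) r'v gact1 scaleN1r.
  exact: addNr.
rewrite /minor_sum big_cons -/(minor_sum _ _) r'h addr0 mulg1 x_minor1 mulr1.
by move/eqP; rewrite oppr_eq0 oner_eq0.
Qed.

Lemma simple_module_unique (L L' : gmodule K (Sp f)) :
  is_simple_module B la L -> is_simple_module B la L' -> gmod_isomorphic L L'.
Proof.
move=> sL sL'.
have [irr _ [[v v0 vla] _]] := sL; have [irr' _ [[v' v'0 v'la] _]] := sL'.
apply: (@cyclic_isomorphic _ _ _ _ v v').
- exact: irreducible_cyclic.
- exact: irreducible_cyclic.
- move=> r; split.
    by move/(annihilator_minor sL v0 vla)/(annihilator_minor sL' v'0 v'la).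
  by move/(annihilator_minor sL' v'0 v'la)/(annihilator_minor sL v0 vla).
Qed.

End Uniqueness.

Theorem proposition3p1 (K : closedFieldType) (char2 : 2%N \in [pchar K])
  (m : nat) (m_ge1 : (1 <= m)%N)
  (V : vectType K) (dimV : \dim {:V} = (2 * m)%N)
  (f : symplectic_form V) (B : symplectic_basis f m) :
  is_simple_module B (fund_weight m m) (DV_cohomology B char2 m) /\
  (forall L : gmodule K (Sp f),
     is_simple_module B (fund_weight m m) L ->
     gmod_isomorphic (DV_cohomology B char2 m) L).
Proof.
have sM := spin_simple B char2.
by split=> [//|L sL]; exact: (@simple_module_unique K V f m B char2 _ L sM sL).
Qed.
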